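(* Let $q$ be a power of a prime $p\ge5$. If $f,g\in\mathbb F_q(X)$ are in Class III-a and $\theta(f)=\theta(g)\neq0$, then $f$ and $g$ are equivalent over $\mathbb F_q$.
   Context: $\mathbb F_q$ is the field with $q$ elements, $\overline{\mathbb F}_q$ an algebraic closure. For a field $K$, $\mathrm{PGL}(2,K)$ is the group of $(aX+b)/(cX+d)$, $a,b,c,d\in K$, $ad-bc\neq0$, under composition; $f,g\in K(X)$ are equivalent over $K$ if $g=\psi\circ f\circ\phi$ with $\psi,\phi\in\mathrm{PGL}(2,K)$. For $s,t\in\mathbb F_q$ with $t(1+s+t)\neq0$, $f_{s,t}=\frac{X^3+sX+t}{X(X-1)}$ and $G_{s,t}=X^4-2X^3-sX^2-2tX+t$. Class III-a is the set of $f\in\mathbb F_q(X)$ equivalent over $\mathbb F_q$ to some such $f_{s,t}$ with $G_{s,t}$ irreducible over $\mathbb F_q$. Ramification index at $a\in\mathbb P^1(\overline{\mathbb F}_q)$: $e_f(a)=\nu_{X-a}(f(X)-f(a))$ if $a,f(a)\ne\infty$; $\nu_{X-a}(1/f)$ if $a\ne\infty=f(a)$; $\nu_X(f(1/X)-f(\infty))$ if $a=\infty\ne f(\infty)$; $\nu_X(1/f(1/X))$ if $a=\infty=f(\infty)$. Every degree-3 $f\in\overline{\mathbb F}_q(X)$ having a point $a$ with $e_f(a)=2$ is equivalent over $\overline{\mathbb F}_q$ to exactly one of $\frac{X^3+1}{X}$ and $\frac{X^3+X^2+t}{X}$ ($0\neq t\in\overline{\mathbb F}_q$); one sets $\theta(f)=0$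 in the first case and $\theta(f)=1/t$ in the second. Functions in Class III-a have a ramification point of index 2, so $\theta$ is defined on them. *)

(* Defs.v *)
From HB Require Import structures.
From mathcomp Require Import all_boot all_algebra.
From mathcomp Require Import boolp classical_sets.

Set Implicit Arguments.
Unset Strict Implicit.
Unset Printing Implicit Defensive.

Import GRing.Theory.
Local Open Scope ring_scope.

(* The field K(X) of rational functions. *)
Notation ratfun K := {fraction {poly K}}.

Section RationalFunctions.
Variable K : fieldType.
Implicit Types (f g h : ratfun K) (a c : K).

Definition ratX : ratfun K := tofrac 'X.
Definition ratC c : ratfun K := tofrac c%:P.

(* Coprime numerator and denominator, determined up to a common factor
   in K^*. *)
Definition rnum f : {poly K} :=
  \n_(repr f) %/ gcdp \n_(repr f) \d_(repr f).
Definition rden f : {poly K} :=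
  \d_(repr f) %/ gcdp \n_(repr f) \d_(repr f).

Definition ratdeg f : nat := (maxn (size (rnum f)) (size (rden f))).-1.

(* f(g(X)); a division by zero (value 0) occurs only if g is a constant that
   is a pole of f. *)
Definition ratcomp f g : ratfun K :=
  (map_poly ratC (rnum f)).[g] / (map_poly ratC (rden f)).[g].

Definition in_PGL2 h : Prop :=
  exists a b c d : K, a * d - b * c != 0 /\
    h = (ratC a * ratX + ratC b) / (ratC c * ratX + ratC d).

Definition requiv f g : Prop :=
  exists psi phi : ratfun K,
    [/\ in_PGL2 psi, in_PGL2 phi & g = ratcomp psi (ratcomp f phi)].

(* Points of P^1(K): [Some a] for a in K, and [None] for infinity. *)
Definition proj1 := option K.

Definition ratval_fin f a : proj1 :=
  if (rden f).[a] == 0 then None else Some ((rnum f).[a] / (rden f).[a]).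

Definition ratval f (x : proj1) : proj1 :=
  if x is Some a then ratval_fin f a else ratval_fin (ratcomp f ratX^-1) 0.

(* nu_{X-a}(f), meaningful for f != 0. *)
Definition ratord a f : int := (mup a (rnum f))%:Z - (mup a (rden f))%:Z.

Definition ramif f (x : proj1) : int :=
  match x, ratval f x with
  | Some a, Some c => ratord a (f - ratC c)
  | Some a, None => ratord a f^-1
  | None, Some c => ratord 0 (ratcomp f ratX^-1 - ratC c)
  | None, None => ratord 0 (ratcomp f ratX^-1)^-1
  end.

(* When K is algebraically closed, exactly one v satisfies this predicate for
   each f of degree 3 having a point of ramification index 2. *)
Definition theta_spec f (v : K) : Prop :=
  [/\ ratdeg f = 3%N, exists x, ramif f x = 2 &
      (v = 0 /\ requiv f ((ratX ^+ 3 + 1) / ratX)) \/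
      (exists t : K, [/\ t != 0, v = t^-1 &
         requiv f ((ratX ^+ 3 + ratX ^+ 2 + ratC t) / ratX)])].

(* The value is 0 for f outside the domain of theta. *)
Definition theta f : K := xget 0 [set v | theta_spec f v]%classic.

Definition fIIIa (s t : K) : ratfun K :=
  (ratX ^+ 3 + ratC s * ratX + ratC t) / (ratX * (ratX - 1)).

Definition GIIIa (s t : K) : {poly K} :=
  'X^4 - 2%:R *: 'X^3 - s *: 'X^2 - (2%:R * t) *: 'X + t%:P.

Definition classIIIa f : Prop :=
  exists s t : K,
    [/\ t * (1 + s + t) != 0, irreducible_poly (GIIIa s t)
      & requiv f (fIIIa s t)].

End RationalFunctions.

Definition ratmap (K L : fieldType) (iota : {rmorphism K -> L})
    (f : ratfun K) : ratfun L :=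
  tofrac (map_poly iota (rnum f)) / tofrac (map_poly iota (rden f)).

Definition is_alg_closure (K : fieldType) (L : closedFieldType)
    (iota : {rmorphism K -> L}) : Prop :=
  forall x : L, algebraicOver iota x.

(* Main.v *)
Require Import Defs.
From HB Require Import structures.
From mathcomp Require Import all_boot all_algebra.
From mathcomp Require Import all_field generic_quotient classical_sets ring.

Set Implicit Arguments.
Unset Strict Implicit.
Unset Printing Implicit Defensive.

Import GRing.Theory.
Local Open Scope ring_scope.

(** Up to composition on the left, a cubic rational function [P / Q] is the
    pencil spanned by the binary cubics [P] and [Q], which is determined by its
    Wronskian quartic and by one further scalar, its apolar invariant.  For
    [f_{s,t}] these are [G_{s,t}] and [s], and
    [theta = s^3 / (t (1 + s + t))].

    Let [x_i] be the conjugates, in Frobenius order, of a root [a] of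
    [G_{s,t}].  Then [u = (x_0 x_2 + x_1 x_3) / s] satisfies
    [u^3 + u^2 = 4 / theta], of which it is the only root in [F_q], because
    [d = (x_0 - x_2)(x_1 - x_3) / s] is a square root of [(1 + u)(1 - 3 u)]
    and Frobenius changes the sign of [d].  So [u] is determined by [theta],
    and [d] up to sign; the sign is absorbed by replacing [a] by its Frobenius
    conjugate.  Given [f_{s,t}] and [f_{s',t'}] with the same nonzero [theta],
    the ordered conjugates [x_i] and [y_i] of suitable roots [a] and [b] then
    have the same cross-ratio, so the determinant with rows
    [(1, x_i, y_i, x_i y_i)] vanishes.  Hence [1], [a], [b], [a b] are linearly
    dependent over [F_q], which is to say that [a] is the image of [b] under
    some [phi] in [PGL(2, F_q)].  The equality of the [d]'s also matches the
    apolar invariants of [f_{s,t} o phi] and [f_{s',t'}], whence their pencils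
    agree. *)

(** * Substitution in rational functions *)

(** Isolated over an abstract field so that [field] faces plain variables; [moebius_comp] applies it
    with [F] the field of rational functions. *)
Lemma moebius_comp_eval (F : fieldType) (a b c d a' b' c' d' h : F) :
  c * h + d != 0 -> (c' * a + d' * c) * h + (c' * b + d' * d) != 0 ->
  (a' * ((a * h + b) / (c * h + d)) + b') /
    (c' * ((a * h + b) / (c * h + d)) + d') =
  ((a' * a + b' * c) * h + (a' * b + b' * d)) /
    ((c' * a + d' * c) * h + (c' * b + d' * d)).
Proof.
by move=> n1 n2; field; rewrite n1 n2.
Qed.

Section RatFun.
Variable K : fieldType.
Implicit Types (f g h : ratfun K) (p q : {poly K}) (a c : K).

Lemma fracE f : f = tofrac \n_(repr f) / tofrac \d_(repr f).
Proof.
have d0 : tofrac \d_(repr f) != 0 :> ratfun K.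
  by rewrite tofrac_eq0 denom_ratioP.
apply: (mulIf d0); rewrite mulfVK //.
move: (repr f) (reprK f) d0 => x <- _.
rewrite !piE; apply/eqmodP => /=; rewrite FracField.equivfE.
by rewrite /FracField.mulf !numden_Ratio ?mulr1 ?oner_eq0 ?denom_ratioP //= mulrC.
Qed.

Lemma rden_neq0 f : rden f != 0.
Proof. by rewrite dvdp_div_eq0 ?dvdp_gcdr // denom_ratioP. Qed.

Lemma coprime_rnum_rden f : coprimep (rnum f) (rden f).
Proof. by apply: coprimep_div_gcd; rewrite denom_ratioP orbT. Qed.

Lemma ratfunE f : f = tofrac (rnum f) / tofrac (rden f).
Proof.
rewrite [LHS]fracE /rnum /rden; set n := \n_(repr f); set d := \d_(repr f).
have nE : tofrac n = tofrac (n %/ gcdp n d) * tofrac (gcdp n d) :> ratfun K.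
  by rewrite -tofracM divpK ?dvdp_gcdl.
have dE : tofrac d = tofrac (d %/ gcdp n d) * tofrac (gcdp n d) :> ratfun K.
  by rewrite -tofracM divpK ?dvdp_gcdr.
rewrite {1}nE {1}dE -mulf_div divff ?mulr1 // tofrac_eq0 gcdp_eq0 negb_and.
by rewrite denom_ratioP orbT.
Qed.

Lemma ratfun_cross p q f : q != 0 ->
  f = tofrac p / tofrac q -> rnum f * q = p * rden f.
Proof.
move=> q0 fE; apply/eqP; rewrite -tofrac_eq !tofracM; apply/eqP.
have := ratfunE f; rewrite {1}fE => e.
have q0' : tofrac q != 0 :> ratfun K by rewrite tofrac_eq0.
have d0' : tofrac (rden f) != 0 :> ratfun K by rewrite tofrac_eq0 rden_neq0.
by rewrite -[tofrac p](mulfVK q0') e mulrAC mulfVK.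
Qed.

(** By Gauss each denominator divides the other, so they are associates, and the numerators follow.
    It compares an arbitrary coprime representation with [rnum] and [rden]. *)
Lemma coprime_cross p q p1 q1 : coprimep p q -> coprimep p1 q1 -> q != 0 ->
  p1 * q = p * q1 -> exists2 k : K, k != 0 & p1 = k *: p /\ q1 = k *: q.
Proof.
move=> co co1 q0 e.
have d1 : q %| q1 by rewrite -(@Gauss_dvdpr _ _ p) 1?coprimep_sym // -e dvdp_mull.
have d2 : q1 %| q by rewrite -(@Gauss_dvdpr _ _ p1) 1?coprimep_sym // e dvdp_mull.
have /eqpP[[k1 k2] /andP[/= k10 k20] ek] : q1 %= q by rewrite /eqp d1 d2.
exists (k1^-1 * k2); first by rewrite mulf_neq0 ?invr_eq0.
have q1E : q1 = (k1^-1 * k2) *: q.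
  by rewrite -scalerA -ek scalerA mulVf // scale1r.
by split=> //; apply: (mulIf q0); rewrite e q1E -scalerAr -scalerAl.
Qed.

Local Notation ratC := (@ratC K).
Local Notation ratX := (@ratX K).

HB.instance Definition _ :=
  GRing.RMorphism.copy ratC (@tofrac {poly K} \o @polyC K).

Lemma horner_ratX p : (map_poly ratC p).[ratX] = tofrac p.
Proof.
have -> : map_poly ratC p = map_poly (@tofrac {poly K}) p^:P.
  by rewrite -map_poly_comp.
by rewrite horner_map -/(comp_poly 'X p) comp_polyXr.
Qed.

Lemma ratX_transcendental : ~ algebraicOver ratC ratX.
Proof.
case=> p p0; rewrite /root horner_ratX tofrac_eq0 => pz.
by rewrite pz in p0.
Qed.

(** Here [h] is arbitrary: [rnum] and [rden] differ from [p] and [q] by one common scalar, so both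
    sides agree even when [q] vanishes at [h]. *)
Lemma ratcomp_coprime p q h : coprimep p q -> q != 0 ->
  ratcomp (tofrac p / tofrac q) h =
    (map_poly ratC p).[h] / (map_poly ratC q).[h].
Proof.
move=> co q0.
have e := ratfun_cross q0 (erefl (tofrac p / tofrac q)).
have [k k0 [pE qE]] := coprime_cross co (coprime_rnum_rden _) q0 e.
rewrite /ratcomp pE qE !map_polyZ !hornerZ -mulf_div divff ?mul1r //.
by rewrite fmorph_eq0.
Qed.

(** This is what makes [f |-> f(h)] a field morphism: no denominator is sent to zero. *)
Definition transcendental h := forall p, p != 0 -> (map_poly ratC p).[h] != 0.

Lemma transcendentalP h : ~ algebraicOver ratC h -> transcendental h.
Proof.
move=> nh p p0; apply/negP => /eqP ph.
by apply: nh; exists p; rewrite // /root ph.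
Qed.

Lemma ratcomp_transcendental p q h : transcendental h -> q != 0 ->
  ratcomp (tofrac p / tofrac q) h =
    (map_poly ratC p).[h] / (map_poly ratC q).[h].
Proof.
move=> th q0.
have /(congr1 (fun r => (map_poly ratC r).[h])) :=
  ratfun_cross q0 (erefl (tofrac p / tofrac q)).
rewrite !rmorphM !hornerM /= => e.
rewrite /ratcomp; set d := (map_poly _ (rden _)).[h] in e *.
have d0 : d != 0 by apply: th; apply: rden_neq0.
by apply/eqP; rewrite eqr_div ?th ?rden_neq0 // e.
Qed.

Section Substitution.
Variables (phi : ratfun K) (tphi : transcendental phi).

(** The proof of transcendence is an argument, so that the ring-morphism structure can be attached
    to [rsubst tphi]. *)
Definition rsubst of transcendental phi := fun f => ratcomp f phi.

Lemma rsubst_zmod : zmod_morphism (rsubst tphi).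
Proof.
move=> f g; rewrite /rsubst (ratfunE f) (ratfunE g).
have f0 := rden_neq0 f; have g0 := rden_neq0 g.
rewrite -mulNr -tofracN addf_div ?tofrac_eq0 // -!tofracM -tofracD.
rewrite !ratcomp_transcendental ?mulf_neq0 // -mulNr addf_div ?tphi //.
by rewrite !(rmorphD, rmorphM, rmorphN) !(hornerD, hornerM, hornerN).
Qed.

Lemma rsubst_monoid : monoid_morphism (rsubst tphi).
Proof.
split=> [|f g]; rewrite /rsubst.
  rewrite -[1](divr1 1) -tofrac1 ratcomp_transcendental ?oner_eq0 // rmorph1 hornerC.
  by rewrite divr1.
rewrite (ratfunE f) (ratfunE g).
have f0 := rden_neq0 f; have g0 := rden_neq0 g.
rewrite mulf_div -!tofracM !ratcomp_transcendental ?mulf_neq0 //.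
by rewrite !rmorphM !hornerM mulf_div.
Qed.

HB.instance Definition _ := GRing.isZmodMorphism.Build _ _ (rsubst tphi) rsubst_zmod.
HB.instance Definition _ := GRing.isMonoidMorphism.Build _ _ (rsubst tphi) rsubst_monoid.

Lemma rsubstC c : rsubst tphi (ratC c) = ratC c.
Proof.
rewrite /rsubst -[ratC c]divr1 -tofrac1.
rewrite ratcomp_transcendental ?oner_eq0 // rmorph1 hornerC.
by rewrite map_polyC hornerC.
Qed.

Lemma rsubstX : rsubst tphi ratX = phi.
Proof.
rewrite /rsubst -[ratX]divr1 -tofrac1 ratcomp_transcendental ?oner_eq0 // rmorph1 hornerC.
by rewrite map_polyX hornerX divr1.
Qed.

Lemma rsubst_horner p h :
  rsubst tphi (map_poly ratC p).[h] = (map_poly ratC p).[rsubst tphi h].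
Proof.
rewrite -horner_map -map_poly_comp; congr (_.[_]); apply: eq_map_poly => c.
exact: rsubstC.
Qed.

(** Associativity of composition: a field morphism that fixes the constants commutes with the
    evaluation of polynomials with constant coefficients, and with division. *)
Lemma rsubst_ratcomp f h : rsubst tphi (ratcomp f h) = ratcomp f (rsubst tphi h).
Proof. by rewrite /ratcomp fmorph_div /= !rsubst_horner. Qed.
End Substitution.

(** * Moebius transformations and equivalence of rational functions *)

Definition moebius a b c d : ratfun K :=
  (ratC a * ratX + ratC b) / (ratC c * ratX + ratC d).

Definition nonconst f := forall c, f <> ratC c.

Lemma moebius_den_neq0 a b c d h : nonconst h -> a * d - b * c != 0 ->
  ratC c * h + ratC d != 0.
Proof.
move=> nh; apply: contra_neqN => /eqP e.
have [c0|c0] := eqVneq c 0.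
  move: e; rewrite c0 rmorph0 mul0r add0r => /eqP; rewrite fmorph_eq0 => /eqP ->.
  by rewrite !mulr0 subr0.
case: (nh (- d / c)); rewrite fmorph_div rmorphN /=.
have cc : ratC c != 0 by rewrite fmorph_eq0.
by apply: (mulfI cc); rewrite mulrCA divff // mulr1; apply/eqP; rewrite -addr_eq0 e.
Qed.

Lemma ratX_nonconst : nonconst ratX.
Proof.
move=> c /eqP; rewrite tofrac_eq => /eqP /(congr1 (fun p : {poly K} => p`_1)).
by rewrite coefX coefC /= => /eqP; rewrite oner_eq0.
Qed.

Lemma ratcomp_moebius a b c d h : a * d - b * c != 0 ->
  ratcomp (moebius a b c d) h = (ratC a * h + ratC b) / (ratC c * h + ratC d).
Proof.
move=> det0.
have E u v : ratC u * ratX + ratC v = tofrac (u%:P * 'X + v%:P).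
  by rewrite tofracD tofracM.
have H u v : (map_poly ratC (u%:P * 'X + v%:P)).[h] = ratC u * h + ratC v.
  by rewrite rmorphD rmorphM /= !map_polyC map_polyX !hornerE.
rewrite /moebius !E ratcomp_coprime ?H //.
  apply/Bezout_coprimepP; exists (- c%:P, a%:P).
  apply/eqpP; exists (1, a * d - b * c); rewrite ?oner_eq0 //=.
  rewrite scale1r -mul_polyC rmorphB !rmorphM /=; ring.
by rewrite -(tofrac_eq0) -E (moebius_den_neq0 ratX_nonconst det0).
Qed.

(** Solving for [ratX] expresses it through constants and the Moebius map, so if the latter were
    algebraic over the constants, [ratX] would be too. *)
Lemma moebius_transcendental a b c d : a * d - b * c != 0 ->
  transcendental (moebius a b c d).
Proof.
move=> det0; apply: transcendentalP => alg.
have cd0 := moebius_den_neq0 ratX_nonconst det0.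
have AC u : algebraicOver ratC (ratC u) by apply: algebraic_id.
pose A := moebius a b c d.
have AE : ratC a * ratX = A * (ratC c * ratX + ratC d) - ratC b.
  by rewrite /A /moebius mulfVK // addrK.
have e1 : ratX * (ratC a - A * ratC c) = A * ratC d - ratC b.
  by rewrite mulrBr mulrC AE; ring.
(* If the equation cannot be solved for [ratX], the rows [(a, b)] and [(c, d)] are proportional with
   factor [A], and the determinant vanishes. *)
have [z|nz] := eqVneq (ratC a - A * ratC c) 0.
  have aE : ratC a = A * ratC c by apply/eqP; rewrite -subr_eq0 z.
  have bE : ratC b = A * ratC d.
    by apply/esym/eqP; rewrite -subr_eq0 -e1 z mulr0.
  suff : ratC (a * d - b * c) = 0 by move/eqP; rewrite fmorph_eq0 (negPf det0).
  by rewrite rmorphB !rmorphM /= aE bE; ring.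
apply: ratX_transcendental.
have -> : ratX = (A * ratC d - ratC b) / (ratC a - A * ratC c) by rewrite -e1 mulfK.
have algA : algebraicOver ratC A := alg.
have algN := algebraic_sub (algebraic_mul algA (AC d)) (AC b).
have algD := algebraic_sub (AC a) (algebraic_mul algA (AC c)).
exact: (algebraic_div algN algD).
Qed.

Lemma ratcomp_ratX f : ratcomp f ratX = f.
Proof. by rewrite /ratcomp !horner_ratX -ratfunE. Qed.

(** The matrix product law. At a constant [h] that is a pole of the inner map, division by zero
    returns 0 and the law can fail; [nonconst] excludes this. *)
Lemma moebius_comp a b c d a' b' c' d' h : nonconst h ->
  a * d - b * c != 0 -> a' * d' - b' * c' != 0 ->
  ratcomp (moebius a' b' c' d') (ratcomp (moebius a b c d) h) =
  ratcomp (moebius (a' * a + b' * c) (a' * b + b' * d)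
               (c' * a + d' * c) (c' * b + d' * d)) h.
Proof.
move=> nh det0 det0'.
have det2 : (a' * a + b' * c) * (c' * b + d' * d) -
            (a' * b + b' * d) * (c' * a + d' * c) != 0.
  rewrite (_ : _ - _ = (a * d - b * c) * (a' * d' - b' * c')) ?mulf_neq0 //.
  ring.
rewrite !ratcomp_moebius //.
have n1 := moebius_den_neq0 nh det0; have n2 := moebius_den_neq0 nh det2.
have CL x y z w : ratC (x * y + z * w) = ratC x * ratC y + ratC z * ratC w.
  by rewrite rmorphD !rmorphM.
rewrite !CL in n2 *.
exact: (moebius_comp_eval (ratC a') (ratC b') n1 n2).
Qed.

Lemma ratcomp_moebius_scalar k h : k != 0 -> ratcomp (moebius k 0 0 k) h = h.
Proof.
move=> k0; rewrite ratcomp_moebius ?mulr0 ?subr0 ?mulf_neq0 // !rmorph0 mul0r add0r addr0.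
by rewrite mulrAC divff ?mul1r // fmorph_eq0.
Qed.

Lemma moebius_det_inv a b c d : a * d - b * c != 0 -> d * a - (- b) * (- c) != 0.
Proof. by rewrite mulrNN mulrC. Qed.

Lemma moebius_invl a b c d h : nonconst h -> a * d - b * c != 0 ->
  ratcomp (moebius d (- b) (- c) a) (ratcomp (moebius a b c d) h) = h.
Proof.
move=> nh det0; rewrite moebius_comp ?moebius_det_inv //.
rewrite (_ : d * a + _ = a * d - b * c); last by ring.
rewrite (_ : d * b + _ = 0); last by ring.
rewrite (_ : - c * a + _ = 0); last by ring.
rewrite (_ : - c * b + _ = a * d - b * c); last by ring.
exact: ratcomp_moebius_scalar.
Qed.

Lemma moebius_invr a b c d : a * d - b * c != 0 ->
  ratcomp (moebius a b c d) (moebius d (- b) (- c) a) = ratX.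
Proof.
move=> det0.
have := moebius_invl ratX_nonconst (moebius_det_inv det0); rewrite !opprK.
by rewrite (ratcomp_ratX (moebius _ _ _ _)).
Qed.

Lemma nonconst_ratcomp f phi : transcendental phi ->
  nonconst (ratcomp f phi) -> nonconst f.
Proof. by move=> tphi nh c fc; apply: (nh c); rewrite fc; apply: rsubstC tphi c. Qed.

Lemma nonconst_moebius a b c d h : a * d - b * c != 0 ->
  nonconst (ratcomp (moebius a b c d) h) -> nonconst h.
Proof.
move=> det0 ng e he; apply: (ng ((a * e + b) / (c * e + d))).
by rewrite ratcomp_moebius // he fmorph_div !rmorphD !rmorphM.
Qed.

Lemma requiv_nonconst f g : requiv f g -> nonconst g -> nonconst f.
Proof.
move=> [_ [_ [[a [b [c [d [det0 ->]]]]] [a' [b' [c' [d' [det0' ->]]]]] ->]]].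
move=> /(nonconst_moebius det0) /nonconst_ratcomp; apply.
exact: moebius_transcendental.
Qed.

Lemma requiv_sym f g : nonconst g -> requiv f g -> requiv g f.
Proof.
move=> ng E; have nf := requiv_nonconst E ng.
move: E => [_ [_ [[a [b [c [d [det0 ->]]]]] [a' [b' [c' [d' [det0' ->]]]]] gE]]].
rewrite -!/(moebius _ _ _ _) in gE.
exists (moebius d (- b) (- c) a), (moebius d' (- b') (- c') a').
split; [by do 4!eexists; split; [exact: moebius_det_inv det0|] |
        by do 4!eexists; split; [exact: moebius_det_inv det0'|] | ].
have t' := moebius_transcendental (moebius_det_inv det0').
rewrite -/(rsubst t' g) gE !rsubst_ratcomp {1}/rsubst moebius_invr //.
by rewrite ratcomp_ratX moebius_invl.
Qed.

Lemma requiv_trans f g h : nonconst h -> requiv f g -> requiv g h -> requiv f h.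
Proof.
move=> nh Efg Egh; have ng := requiv_nonconst Egh nh.
have nf := requiv_nonconst Efg ng.
move: Efg => [_ [_ [[a [b [c [d [D1 ->]]]]] [a' [b' [c' [d' [D1' ->]]]]] gE]]].
move: Egh => [_ [_ [[e [k [l [m [D2 ->]]]]] [e' [k' [l' [m' [D2' ->]]]]] hE]]].
rewrite -!/(moebius _ _ _ _) in gE hE.
have t2 := moebius_transcendental D2'.
rewrite -/(rsubst t2 g) gE !rsubst_ratcomp {1}/rsubst in hE.
(* Writing the inner map as its own composite with [ratX] brings the two right-hand maps into the
   shape of [moebius_comp]. *)
rewrite -[moebius e' k' l' m']ratcomp_ratX (moebius_comp ratX_nonconst D2' D1') in hE.
rewrite ratcomp_ratX in hE; rewrite hE in nh.
rewrite (moebius_comp (nonconst_moebius D1 (nonconst_moebius D2 nh)) D1 D2) in hE.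
eexists; eexists; split; last exact: hE.
  do 4!eexists; split; last by [].
  by rewrite (_ : _ - _ = (a * d - b * c) * (e * m - k * l)) ?mulf_neq0 //; ring.
do 4!eexists; split; last by [].
by rewrite (_ : _ - _ = (a' * d' - b' * c') * (e' * m' - k' * l')) ?mulf_neq0 //; ring.
Qed.

End RatFun.

(** * Base change of rational functions along a field embedding *)

Section RatMap.
Variables (K L : fieldType) (iota : {rmorphism K -> L}).
Implicit Types (f g h : ratfun K) (p q : {poly K}) (c : K).

Lemma ratmap_frac p q : q != 0 ->
  ratmap iota (tofrac p / tofrac q) =
    tofrac (map_poly iota p) / tofrac (map_poly iota q).
Proof.
move=> q0.
have /(congr1 (map_poly iota)) := ratfun_cross q0 (erefl (tofrac p / tofrac q)).
rewrite !rmorphM /= => e.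
apply/eqP; rewrite /ratmap eqr_div ?tofrac_eq0 ?map_poly_eq0 ?rden_neq0 //.
by rewrite -!tofracM e.
Qed.

Lemma ratmap_zmod : zmod_morphism (ratmap iota).
Proof.
move=> f g; rewrite (ratfunE f) (ratfunE g).
have f0 := rden_neq0 f; have g0 := rden_neq0 g.
rewrite -mulNr -tofracN addf_div ?tofrac_eq0 // -!tofracM -tofracD.
rewrite !ratmap_frac ?mulf_neq0 // -mulNr addf_div ?tofrac_eq0 ?map_poly_eq0 //.
by rewrite !(rmorphD, rmorphM, rmorphN).
Qed.

Lemma ratmap_monoid : monoid_morphism (ratmap iota).
Proof.
split=> [|f g].
  by rewrite -[1](divr1 1) -tofrac1 ratmap_frac ?oner_eq0 // !rmorph1 divr1.
rewrite (ratfunE f) (ratfunE g).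
have f0 := rden_neq0 f; have g0 := rden_neq0 g.
by rewrite mulf_div -!tofracM !ratmap_frac ?mulf_neq0 // !rmorphM mulf_div.
Qed.

HB.instance Definition _ :=
  GRing.isZmodMorphism.Build _ _ (ratmap iota) ratmap_zmod.
HB.instance Definition _ :=
  GRing.isMonoidMorphism.Build _ _ (ratmap iota) ratmap_monoid.

Lemma ratmap_tofrac p : ratmap iota (tofrac p) = tofrac (map_poly iota p).
Proof. by rewrite -[tofrac p]divr1 -tofrac1 ratmap_frac ?oner_eq0 // !rmorph1 divr1. Qed.

Lemma ratmapC c : ratmap iota (ratC c) = ratC (iota c).
Proof. by rewrite ratmap_tofrac map_polyC. Qed.

Lemma ratmapX : ratmap iota (ratX K) = ratX L.
Proof. by rewrite ratmap_tofrac map_polyX. Qed.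

(** Coprimality survives field extension, so the images of [rnum f] and [rden f] are again a coprime
    representation and [ratcomp_coprime] applies. *)
Lemma ratmap_ratcomp f h :
  ratmap iota (ratcomp f h) = ratcomp (ratmap iota f) (ratmap iota h).
Proof.
rewrite [in RHS]/ratmap ratcomp_coprime; last 2 first.
- by rewrite coprimep_map coprime_rnum_rden.
- by rewrite map_poly_eq0 rden_neq0.
have H p : ratmap iota (map_poly (@ratC K) p).[h] =
    (map_poly (@ratC L) (map_poly iota p)).[ratmap iota h].
  rewrite -horner_map -!map_poly_comp; congr (_.[_]).
  by apply: eq_map_poly => c; apply: ratmapC.
by rewrite /ratcomp fmorph_div /= !H.
Qed.

Lemma in_PGL2_ratmap h : in_PGL2 h -> in_PGL2 (ratmap iota h).
Proof.
move=> [a [b [c [d [det0 ->]]]]].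
exists (iota a), (iota b), (iota c), (iota d); split.
  by rewrite -!rmorphM -rmorphB fmorph_eq0.
by rewrite fmorph_div !rmorphD !rmorphM /= !ratmapC ratmapX.
Qed.

Lemma requiv_ratmap f g : requiv f g -> requiv (ratmap iota f) (ratmap iota g).
Proof.
move=> [psi [phi [hpsi hphi ->]]].
exists (ratmap iota psi), (ratmap iota phi).
by rewrite -!ratmap_ratcomp; split=> //; apply: in_PGL2_ratmap.
Qed.

Lemma ratmap_fIIIa s t :
  ratmap iota (fIIIa s t) = fIIIa (iota s) (iota t).
Proof.
rewrite /fIIIa fmorph_div !(rmorphXn, rmorphB, rmorphD, rmorphM, rmorph1) /=.
by rewrite !ratmapC ratmapX.
Qed.

End RatMap.

(** * Pencils of cubics *)

Section Cubics.
Variable K : fieldType.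
Implicit Types (s t T : K).
Local Notation ratC := (@ratC K).
Local Notation ratX := (@ratX K).

Definition cubic (p3 p2 p1 p0 : K) : {poly K} :=
  p3%:P * 'X^3 + p2%:P * 'X^2 + p1%:P * 'X + p0%:P.

Lemma coef_cubic (p3 p2 p1 p0 : K) i :
  (cubic p3 p2 p1 p0)`_i = [:: p0; p1; p2; p3]`_i.
Proof.
rewrite !coefD !coefCM coefC coefX !coefXn.
by case: i => [|[|[|[|i]]]] /=; rewrite ?nth_nil !(mulr0, mulr1, add0r, addr0).
Qed.

Lemma tofrac_cubic (p3 p2 p1 p0 : K) : tofrac (cubic p3 p2 p1 p0) =
  ratC p3 * ratX ^+ 3 + ratC p2 * ratX ^+ 2 + ratC p1 * ratX + ratC p0.
Proof. by rewrite /cubic !(tofracD, tofracM, tofracXn). Qed.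

Lemma fIIIa_frac s t :
  fIIIa s t = tofrac (cubic 1 0 s t) / tofrac (cubic 0 1 (-1) 0).
Proof.
rewrite /fIIIa !tofrac_cubic !(rmorph0, rmorph1, rmorphN1).
by congr (_ / _); ring.
Qed.

(* Up to sign, the resultant of two binary cubics, as the determinant of their
   Bezout matrix; unlike [apolar] it depends on the pencil cubically. *)
Definition bezout (p3 p2 p1 p0 q3 q2 q1 q0 : K) : K :=
  let p01 := p0 * q1 - p1 * q0 in
  let p02 := p0 * q2 - p2 * q0 in
  let p03 := p0 * q3 - p3 * q0 in
  let p12 := p1 * q2 - p2 * q1 in
  let p13 := p1 * q3 - p3 * q1 in
  let p23 := p2 * q3 - p3 * q2 in
  p01 * ((p03 + p12) * p23 - p13 ^+ 2) - p02 * (p02 * p23 - p03 * p13)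
  + p03 * (p02 * p13 - p03 * (p03 + p12)).

(* Three times the SL_2-invariant alternating form on binary cubics. *)
Definition apolar (p3 p2 p1 p0 q3 q2 q1 q0 : K) : K :=
  p1 * q2 - p2 * q1 - 3 * (p0 * q3 - p3 * q0).

(* [num_subi] and [den_subi] are the coefficients of [X^i] in the numerator and
   denominator of [f_{s,t} o (m1 X + m2) / (m3 X + m4)], fractions cleared. *)
Section CubicSubstitution.
Variables s t m1 m2 m3 m4 : K.
Definition num_sub3 := m1 ^+ 3 + s * m1 * m3 ^+ 2 + t * m3 ^+ 3.
Definition num_sub2 := 3 * m1 ^+ 2 * m2 + s * (m2 * m3 ^+ 2 + 2 * m1 * m3 * m4)
  + 3 * t * m3 ^+ 2 * m4.
Definition num_sub1 := 3 * m1 * m2 ^+ 2 + s * (2 * m2 * m3 * m4 + m1 * m4 ^+ 2)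
  + 3 * t * m3 * m4 ^+ 2.
Definition num_sub0 := m2 ^+ 3 + s * m2 * m4 ^+ 2 + t * m4 ^+ 3.
Definition den_sub3 := m1 ^+ 2 * m3 - m1 * m3 ^+ 2.
Definition den_sub2 := 2 * m1 * m2 * m3 + m1 ^+ 2 * m4
  - (m2 * m3 ^+ 2 + 2 * m1 * m3 * m4).
Definition den_sub1 := m2 ^+ 2 * m3 + 2 * m1 * m2 * m4
  - (2 * m2 * m3 * m4 + m1 * m4 ^+ 2).
Definition den_sub0 := m2 ^+ 2 * m4 - m2 * m4 ^+ 2.

(** The form is invariant of weight 3, and its value on the pair [X^3 + s X + t], [X^2 - X] is
    [s]. *)
Lemma apolar_sub :
  apolar num_sub3 num_sub2 num_sub1 num_sub0
         den_sub3 den_sub2 den_sub1 den_sub0 = s * (m1 * m4 - m2 * m3) ^+ 3.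
Proof.
rewrite /apolar /num_sub3 /num_sub2 /num_sub1 /num_sub0.
by rewrite /den_sub3 /den_sub2 /den_sub1 /den_sub0; ring.
Qed.

(** The resultant of two binary cubics has weight 9. For [f_{s,t}] it is the product of the values
    [t], [1 + s + t] and [1] of the numerator at the zeros [0], [1] and infinity of the
    denominator. *)
Lemma bezout_sub :
  bezout num_sub3 num_sub2 num_sub1 num_sub0
         den_sub3 den_sub2 den_sub1 den_sub0 =
    t * (1 + s + t) * (m1 * m4 - m2 * m3) ^+ 9.
Proof.
rewrite /bezout /num_sub3 /num_sub2 /num_sub1 /num_sub0.
by rewrite /den_sub3 /den_sub2 /den_sub1 /den_sub0; cbv zeta; ring.
Qed.

Lemma ratcomp_fIIIa_moebius : m1 * m4 - m2 * m3 != 0 ->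
  ratcomp (fIIIa s t) (moebius m1 m2 m3 m4) =
    tofrac (cubic num_sub3 num_sub2 num_sub1 num_sub0) /
    tofrac (cubic den_sub3 den_sub2 den_sub1 den_sub0).
Proof.
move=> det0.
have t0 := moebius_transcendental det0.
have n0 := moebius_den_neq0 (@ratX_nonconst K) det0.
rewrite -/(rsubst t0 _) fIIIa_frac fmorph_div /= !tofrac_cubic.
set N := _ + ratC num_sub0; set D := _ + ratC den_sub0.
rewrite !(rmorphXn, rmorphD, rmorphM) /= !rsubstC !rsubstX.
(* Numerator and denominator are both homogenised to degree 3 by the factor [n ^+ 3], which cancels
   in the quotient. *)
pose n := ratC m3 * ratX + ratC m4.
have phiE : moebius m1 m2 m3 m4 * n = ratC m1 * ratX + ratC m2 by rewrite mulfVK.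
move: (moebius _ _ _ _) phiE => phi phiE.
have NE : N = (phi ^+ 3 + ratC s * phi + ratC t) * n ^+ 3.
  transitivity ((phi * n) ^+ 3 + ratC s * (phi * n) * n ^+ 2 + ratC t * n ^+ 3).
    rewrite phiE /N /n /num_sub3 /num_sub2 /num_sub1 /num_sub0.
    rewrite !(rmorph_nat, rmorphXn, rmorphD, rmorphM) /=; ring.
  by ring.
have DE : D = (phi ^+ 2 - phi) * n ^+ 3.
  transitivity (((phi * n) ^+ 2 - phi * n * n) * n).
    rewrite phiE /D /n /den_sub3 /den_sub2 /den_sub1 /den_sub0.
    rewrite !(rmorph_nat, rmorphXn, rmorphB, rmorphD, rmorphM) /=; ring.
  by ring.
rewrite NE DE -mulf_div divff ?expf_neq0 // mulr1 !(rmorph0, rmorph1, rmorphN1).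
by congr (_ / _); ring.
Qed.
End CubicSubstitution.


Lemma cubic_nonconst (p3 p2 p1 p0 q2 q1 q0 : K) : p3 != 0 ->
  tofrac (cubic 0 q2 q1 q0) != 0 ->
  nonconst (tofrac (cubic p3 p2 p1 p0) / tofrac (cubic 0 q2 q1 q0)).
Proof.
move=> p30 q0n c /(canRL (divfK q0n))/eqP; rewrite -tofracM tofrac_eq => /eqP e.
have := congr1 (fun p : {poly K} => p`_3) e.
by rewrite coefCM !coef_cubic /= mulr0 => /eqP; rewrite (negPf p30).
Qed.

Lemma cubic_neq0 (p3 p2 p1 p0 : K) :
  [|| p3 != 0, p2 != 0, p1 != 0 | p0 != 0] -> tofrac (cubic p3 p2 p1 p0) != 0.
Proof.
rewrite tofrac_eq0; apply: contraTneq => e.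
have C i := coef_cubic p3 p2 p1 p0 i; rewrite e in C.
have := (C 0%N, C 1%N, C 2%N, C 3%N); rewrite !coef0 /= => -[[[<- <-] <-] <-].
by rewrite eqxx.
Qed.

Lemma fIIIa_nonconst s t : nonconst (fIIIa s t).
Proof.
rewrite fIIIa_frac; apply: cubic_nonconst; rewrite ?oner_eq0 //.
by apply: cubic_neq0; rewrite oner_eq0 orbT.
Qed.

(** * The normal form with nonzero theta, and the value of theta on [f_{s,t}] *)

Definition normal_form T : ratfun K := (ratX ^+ 3 + ratX ^+ 2 + ratC T) / ratX.

Lemma normal_form_frac T :
  normal_form T = tofrac (cubic 1 1 0 T) / tofrac (cubic 0 0 1 0).
Proof.
rewrite /normal_form !tofrac_cubic !(rmorph0, rmorph1).
by congr (_ / _); ring.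
Qed.

Lemma normal_form_nonconst T : nonconst (normal_form T).
Proof.
rewrite normal_form_frac; apply: cubic_nonconst; rewrite ?oner_eq0 //.
by apply: cubic_neq0; rewrite oner_eq0 !orbT.
Qed.

Lemma cubic_lin (a b p3 p2 p1 p0 q3 q2 q1 q0 : K) :
  ratC a * tofrac (cubic p3 p2 p1 p0) + ratC b * tofrac (cubic q3 q2 q1 q0) =
  tofrac (cubic (a * p3 + b * q3) (a * p2 + b * q2) (a * p1 + b * q1)
                (a * p0 + b * q0)).
Proof. by rewrite !tofrac_cubic !rmorphD !rmorphM /=; ring. Qed.

Lemma ratcomp_moebius_frac (a b c d p3 p2 p1 p0 q3 q2 q1 q0 : K) :
  a * d - b * c != 0 -> tofrac (cubic q3 q2 q1 q0) != 0 ->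
  ratcomp (moebius a b c d)
    (tofrac (cubic p3 p2 p1 p0) / tofrac (cubic q3 q2 q1 q0)) =
  tofrac (cubic (a * p3 + b * q3) (a * p2 + b * q2) (a * p1 + b * q1)
                (a * p0 + b * q0)) /
  tofrac (cubic (c * p3 + d * q3) (c * p2 + d * q2) (c * p1 + d * q1)
                (c * p0 + d * q0)).
Proof.
move=> det0 q0n; rewrite ratcomp_moebius // -!cubic_lin.
rewrite -[in RHS](divfK q0n (tofrac (cubic p3 p2 p1 p0))).
move: (_ / tofrac _) => w; rewrite !mulrA -!mulrDl -mulf_div divff // mulr1.
by [].
Qed.

(** Being cubic in the 2 by 2 minors of the pencil, [bezout] acquires the cube of the determinant,
    while [apolar] is linear in them. With [apolar_sub] and [bezout_sub], the quotient
    [apolar ^+ 3 / bezout] is therefore unchanged by equivalence on either side; on the normal form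
    it is [(-1)^3 / (- T)], that is [1 / T]. *)
Lemma bezout_lin (a b c d p3 p2 p1 p0 q3 q2 q1 q0 : K) :
  bezout (a * p3 + b * q3) (a * p2 + b * q2) (a * p1 + b * q1) (a * p0 + b * q0)
    (c * p3 + d * q3) (c * p2 + d * q2) (c * p1 + d * q1) (c * p0 + d * q0) =
  (a * d - b * c) ^+ 3 * bezout p3 p2 p1 p0 q3 q2 q1 q0.
Proof. rewrite /bezout; cbv zeta; ring. Qed.

Lemma apolar_lin (a b c d p3 p2 p1 p0 q3 q2 q1 q0 : K) :
  apolar (a * p3 + b * q3) (a * p2 + b * q2) (a * p1 + b * q1) (a * p0 + b * q0)
    (c * p3 + d * q3) (c * p2 + d * q2) (c * p1 + d * q1) (c * p0 + d * q0) =
  (a * d - b * c) * apolar p3 p2 p1 p0 q3 q2 q1 q0.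
Proof. rewrite /apolar; ring. Qed.

(** For nonzero [T] the polynomials [X^3 + X^2 + T] and [X] are coprime, so any other representation
    multiplies both by a common factor, and the degree bound 3 makes that factor a constant [k]. The
    proof reads this off the coefficients of the cross product. *)
Lemma normal_form_pencil T (p3 p2 p1 p0 q3 q2 q1 q0 : K) : T != 0 ->
  tofrac (cubic q3 q2 q1 q0) != 0 ->
  tofrac (cubic p3 p2 p1 p0) / tofrac (cubic q3 q2 q1 q0) = normal_form T ->
  exists2 k, k != 0 & [/\ p3 = k, p2 = k, p1 = 0, p0 = T * k &
    [/\ q3 = 0, q2 = 0, q1 = k & q0 = 0]].
Proof.
move=> T0 q0n; rewrite normal_form_frac => /eqP.
have XE : cubic 0 0 1 0 = 'X.
  by rewrite /cubic !rmorph0 rmorph1 !mul0r !add0r mul1r addr0.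
have TE : cubic 1 1 0 T = 'X^3 + 'X^2 + T%:P.
  by rewrite /cubic !rmorph0 rmorph1 !mul0r addr0 !mul1r.
have X0 : tofrac ('X : {poly K}) != 0 by rewrite tofrac_eq0 polyX_eq0.
rewrite XE TE (eqr_div _ _ q0n X0) -!tofracM tofrac_eq => /eqP e.
have C i : (cubic p3 p2 p1 p0 * 'X)`_i =
    ((cubic q3 q2 q1 q0) * ('X^3 + 'X^2 + T%:P))`_i by rewrite e mulrC.
have := (C 0%N, C 1%N, C 2%N, C 3%N, C 4%N, C 5%N, C 6%N).
rewrite !mulrDr !coefD !coefMX !coefMXn !coefMC !coef_cubic /=.
rewrite !mul0r !add0r !addr0.
move=> [[[[[[/esym/eqP C0 C1] C2] C3] C4] C5] q3z]; move: C0 C1 C2 C3 C4 C5.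
rewrite -q3z mulf_eq0 (negPf T0) orbF addr0 => /eqP q0z C1 C2 C3 C4 q2z.
move: C2 C3 C4; rewrite q0z -q2z mul0r !addr0 !add0r => C2 C3 C4.
exists q1; last by split; rewrite ?C1 1?mulrC ?C3 ?mul0r ?addr0.
apply: contraNneq q0n => q1z.
by rewrite -q3z -q2z q1z q0z /cubic !rmorph0 !mul0r !addr0 rmorph0.
Qed.

(** Both invariants of the transformed pencil are computed twice. On the normal form scaled by [k]
    they are [- k ^+ 2] and [- T * k ^+ 6]; on the side of [f_{s,t}] they are [s] and
    [t (1 + s + t)] times powers of the two determinants. Eliminating [k] gives the relation. *)
Lemma requiv_fIIIa_normal_form s t T : T != 0 -> requiv (fIIIa s t) (normal_form T) ->
  s != 0 /\ t * (1 + s + t) = T * s ^+ 3.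
Proof.
move=> T0 [_ [_ [[a [b [c [d [D1 ->]]]]] [m1 [m2 [m3 [m4 [D2 ->]]]]] E]]].
rewrite -!/(moebius _ _ _ _) in E.
have nh : nonconst (ratcomp (fIIIa s t) (moebius m1 m2 m3 m4)).
  by apply: (nonconst_moebius D1); rewrite -E; apply: normal_form_nonconst.
rewrite (ratcomp_fIIIa_moebius _ _ D2) in nh E.
have := apolar_sub s t m1 m2 m3 m4; have := bezout_sub s t m1 m2 m3 m4.
move: (num_sub3 _ _ _ _) (num_sub2 _ _ _ _ _ _) (num_sub1 _ _ _ _ _ _)
  (num_sub0 _ _ _ _) nh E.
move: (den_sub3 _ _) (den_sub2 _ _ _ _) (den_sub1 _ _ _ _) (den_sub0 _ _).
move=> q3 q2 q1 q0 p3 p2 p1 p0 nh E eB eA.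
have q0n : tofrac (cubic q3 q2 q1 q0) != 0.
  by apply/eqP => z; apply: (nh 0); rewrite z invr0 mulr0 rmorph0.
have B0 := moebius_den_neq0 nh D1.
rewrite ratcomp_moebius_frac // in E.
have {}B0 : tofrac (cubic (c * p3 + d * q3) (c * p2 + d * q2) (c * p1 + d * q1)
                (c * p0 + d * q0)) != 0.
  apply/eqP => z; apply: (@normal_form_nonconst T 0).
  by rewrite E z invr0 mulr0 rmorph0.
have [k k0 [e3 e2 e1 e0 [e7 e6 e5 e4]]] := normal_form_pencil T0 B0 (esym E).
have := bezout_lin a b c d p3 p2 p1 p0 q3 q2 q1 q0.
have := apolar_lin a b c d p3 p2 p1 p0 q3 q2 q1 q0.
rewrite e3 e2 e1 e0 e7 e6 e5 e4 eA eB /apolar /bezout; cbv zeta.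
set D := a * d - b * c in D1 *; set D' := m1 * m4 - _ in D2 *.
move=> eqA eqB.
have eA' : D * D' ^+ 3 * s = - k ^+ 2.
  by transitivity (D * (s * D' ^+ 3)); [ring | rewrite -eqA; ring].
have DD : D * D' ^+ 3 != 0 by rewrite mulf_neq0 ?expf_neq0.
split.
  apply: contraNneq k0 => s0; move/eqP: eA'.
  by rewrite s0 mulr0 eq_sym oppr_eq0 expf_eq0.
apply: (mulfI (expf_neq0 3 DD)).
transitivity (T * (D * D' ^+ 3 * s) ^+ 3); last by ring.
rewrite eA'; transitivity (D ^+ 3 * (t * (1 + s + t) * D' ^+ 9)); first by ring.
by rewrite -eqB; ring.
Qed.
End Cubics.

(** * Conjugates over a finite field *)

Lemma irreducible_dvdp_root (F L : fieldType) (iota : {rmorphism F -> L})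
    (G r : {poly F}) (a : L) : irreducible_poly G ->
  root (map_poly iota G) a -> root (map_poly iota r) a -> G %| r.
Proof.
move=> irrG ra rr; apply: contraT => ndvd.
have co : coprimep G r by rewrite irreducible_poly_coprime.
have : coprimep (map_poly iota G) (map_poly iota r) by rewrite coprimep_map.
by move=> /coprimep_root/(_ ra); rewrite -[_ == 0]/(root _ _) rr.
Qed.

Section FiniteField.
Variables (F : finFieldType) (L : splittingFieldType F).
Local Notation toL := (map_poly (in_alg L)).

Lemma frobenius_rmorphism :
  exists sigma : {rmorphism L -> L}, forall x, sigma x = x ^+ #|F|.
Proof.
have [alpha _ aE] := finField_galois_generator (sub1v {:L}%AS).
exists (gal_repr alpha : {rmorphism L -> L}) => x.
have := aE x (memvf x). by rewrite dimv1 expn1.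
Qed.

Variables (sigma : {rmorphism L -> L}) (sigmaE : forall x, sigma x = x ^+ #|F|).

Lemma frobenius_fixed x : sigma x = x -> exists c : F, x = c%:A.
Proof.
move=> sx; suff : x \in 1%VS by case/vlineP=> c ->; exists c.
by rewrite Fermat's_little_theorem /= dimv1 expn1 -sigmaE sx.
Qed.

Lemma frobenius_alg (c : F) : sigma c%:A = c%:A.
Proof.
have : c%:A \in (1%AS : {subfield L}) by rewrite memvZ ?mem1v.
by rewrite Fermat's_little_theorem /= dimv1 expn1 -sigmaE => /eqP.
Qed.

Lemma frobenius_horner (r : {poly F}) x : sigma (toL r).[x] = (toL r).[sigma x].
Proof.
rewrite -horner_map -map_poly_comp; congr (_.[_]).
by apply: eq_map_poly => c; apply: frobenius_alg.
Qed.

Lemma iter_frobenius k x : iter k sigma x = x ^+ (#|F| ^ k).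
Proof. by elim: k => [|k IH] /=; rewrite ?expr1 // IH sigmaE -exprM expnSr. Qed.

Section Root.
Variables (G : {poly F}) (a : L).
Hypotheses (irrG : irreducible_poly G) (rootG : root (toL G) a).

(** [G] and the minimal polynomial of [a], which has coefficients in [F], divide each other. *)
Lemma dim_adjoin_root : \dim <<1; a>> = (size G).-1.
Proof.
rewrite dim_Fadjoin dimv1 muln1.
have /polyOver1P[r rE] := minPolyOver 1 a.
have dG : G %| r.
  by apply: (irreducible_dvdp_root irrG rootG); rewrite -rE root_minPoly.
have dr : r %| G.
  by rewrite -(dvdp_map (in_alg L)) -rE minPoly_dvdp ?alg_polyOver.
have := size_minPoly 1 a; rewrite rE size_map_poly.
by rewrite -(eqp_size (_ : G %= r)) ?/eqp ?dG // => ->.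
Qed.

Lemma frobenius_period : iter (size G).-1 sigma a = a.
Proof.
apply/eqP; rewrite iter_frobenius -dim_adjoin_root.
by rewrite -(Fermat's_little_theorem <<1; a>>%AS) memv_adjoin.
Qed.

Lemma adjoin_rootP u : u \in <<1; a>>%VS ->
  exists2 r : {poly F}, (size r < size G)%N & u = (toL r).[a].
Proof.
move=> /Fadjoin_poly_eq uE.
have /polyOver1P[r rE] := Fadjoin_polyOver 1 a u.
exists r; last by rewrite -rE uE.
rewrite -(size_map_poly (in_alg L)) -rE (leq_ltn_trans (size_Fadjoin_poly _ _ _)) //.
have := dim_adjoin_root; rewrite dim_Fadjoin dimv1 muln1 => ->.
by case: irrG => sG _; rewrite prednK // ltnW.
Qed.

End Root.

(** Inside [L] a subfield over [F] is determined by its dimension, since it consists of the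
    solutions of the corresponding Fermat equation. *)
Lemma adjoin_root_eq (G H : {poly F}) (a b : L) :
  irreducible_poly G -> root (toL G) a ->
  irreducible_poly H -> root (toL H) b -> size G = size H ->
  <<1; a>>%VS = <<1; b>>%VS.
Proof.
move=> iG rG iH rH sz; apply/vspaceP => x.
rewrite (Fermat's_little_theorem <<1; a>>%AS) (Fermat's_little_theorem <<1; b>>%AS).
by rewrite /= (dim_adjoin_root iG rG) (dim_adjoin_root iH rH) sz.
Qed.

Section QuarticRoots.
Variables (G : {poly F}) (a : L).
Hypotheses (irrG : irreducible_poly G) (rootG : root (toL G) a).
Hypotheses (sizeG : size G = 5%N) (monG : G \is monic).

Lemma frobenius4 : sigma (sigma (sigma (sigma a))) = a.
Proof. by have := frobenius_period irrG rootG; rewrite sizeG. Qed.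

(** Otherwise [a + sigma a] and [a * sigma a] would lie in [F], and [a] would be a root of a
    quadratic over [F]. *)
Lemma frobenius2_neq : sigma (sigma a) != a.
Proof.
apply/eqP => s2.
have [c cE] : exists c : F, a + sigma a = c%:A.
  by apply: frobenius_fixed; rewrite rmorphD s2 addrC.
have [d dE] : exists d : F, a * sigma a = d%:A.
  by apply: frobenius_fixed; rewrite rmorphM s2 mulrC.
pose r : {poly F} := 'X^2 - c *: 'X + d%:P.
have szr : size r = 3%N.
  rewrite /r -addrA size_polyDl size_polyXn //.
  rewrite (leq_ltn_trans (size_polyD _ _)) // gtn_max size_polyN.
  rewrite (leq_ltn_trans (size_scale_leq _ _)) ?size_polyX // size_polyC.
  by case: (_ != _).
have rr : root (toL r) a.
  rewrite /r rmorphD rmorphB /= map_polyXn map_polyZ map_polyX map_polyC /=.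
  by rewrite /root !hornerE -dE -cE; apply/eqP; ring.
have := dvdp_leq _ (irreducible_dvdp_root irrG rootG rr).
by rewrite sizeG szr -size_poly_eq0 szr => /(_ isT).
Qed.

Lemma frobenius_uniq :
  uniq [:: a; sigma a; sigma (sigma a); sigma (sigma (sigma a))].
Proof.
have n2 := frobenius2_neq; have s4 := frobenius4.
have n1 : sigma a != a by apply: contraNneq n2 => e; rewrite !e.
have n3 : sigma (sigma (sigma a)) != a.
  by apply: contraNneq n1 => e; rewrite -[X in _ == X]s4 e.
rewrite /= !inE !negb_or !(inj_eq (fmorph_inj sigma)).
by rewrite ![a == _]eq_sym n1 n2 n3.
Qed.

Lemma quartic_factor : toL G =
  ('X - a%:P) * ('X - (sigma a)%:P) * ('X - (sigma (sigma a))%:P) *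
  ('X - (sigma (sigma (sigma a)))%:P).
Proof.
have ra x : root (toL G) x -> root (toL G) (sigma x).
  by move=> /rootP r0; apply/rootP; rewrite -frobenius_horner r0 rmorph0.
rewrite [LHS](@all_roots_prod_XsubC _ _
  [:: a; sigma a; sigma (sigma a); sigma (sigma (sigma a))]).
- rewrite lead_coef_map (monicP monG) rmorph1 scale1r.
  by rewrite !big_cons big_nil mulr1 !mulrA.
- by rewrite size_map_poly.
- have r1 := ra _ rootG; have r2 := ra _ r1; have r3 := ra _ r2.
  by rewrite /= rootG r1 r2 r3.
- by rewrite uniq_rootsE frobenius_uniq.
Qed.
End QuarticRoots.

(** Expanding each [u j] in powers of [a] factors the matrix of conjugates as a coefficient matrix
    over [F] times the Vandermonde matrix of the conjugates of [a]. The latter is invertible, so the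
    coefficient matrix is singular and a dependence already exists over [F]. *)
Lemma adjoin_dep (G : {poly F}) (a : L) (u : 'I_4 -> L) :
  irreducible_poly G -> root (toL G) a -> size G = 5%N ->
  (forall j, u j \in <<1; a>>%VS) ->
  \det (\matrix_(j < 4, i < 4) iter i sigma (u j)) = 0 ->
  exists2 v : 'rV[F]_4, v != 0 & \sum_j v 0 j *: u j = 0.
Proof.
move=> irrG rootG sizeG uP det0.
have rP j : exists r : {poly F}, (size r <= 4)%N && (u j == (toL r).[a]).
  have [r sr ur] := adjoin_rootP irrG rootG (uP j).
  by exists r; rewrite -ltnS -sizeG sr ur /=.
pose r j := xchoose (rP j).
have sr j : (size (r j) <= 4)%N by have /andP[] := xchooseP (rP j).
have ur j : u j = (toL (r j)).[a] by have /andP[_ /eqP] := xchooseP (rP j).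
pose C := \matrix_(j < 4, k < 4) (r j)`_k.
pose x := \row_(i < 4) iter i sigma a.
have iterE i j : iter i sigma (u j) = (toL (r j)).[iter i sigma a].
  by elim: i => [|i IH] /=; [exact: ur | rewrite IH frobenius_horner].
have ME : \matrix_(j < 4, i < 4) iter i sigma (u j) =
    map_mx (in_alg L) C *m Vandermonde 4 x.
  apply/matrixP => j i; rewrite !mxE iterE (@horner_coef_wide _ 4) ?size_map_poly //.
  by apply: eq_bigr => k _; rewrite !mxE coef_map.
have V0 : \det (Vandermonde 4 x) != 0.
  rewrite det_Vandermonde; apply/prodf_neq0 => i _; apply/prodf_neq0 => j ij.
  rewrite !mxE subr_eq0.
  have := frobenius_uniq irrG rootG sizeG.
  move/(nth_uniq 0) => /(_ j i (ltn_ord j) (ltn_ord i)).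
  have nE (k : 'I_4) : [:: a; sigma a; sigma (sigma a);
      sigma (sigma (sigma a))]`_k = iter k sigma a.
    by case: k => [[|[|[|[|k]]]] lk].
  by rewrite !nE => ->; rewrite neq_ltn ij orbT.
have : \det C == 0.
  move/eqP: det0; rewrite ME det_mulmx mulf_eq0 (negPf V0) orbF.
  by rewrite det_map_mx fmorph_eq0.
case/det0P => v v0 vC; exists v => //.
have vC' k : \sum_j v 0 j * (r j)`_k = 0.
  have [k4|k4] := ltnP k 4; last first.
    by rewrite big1 // => j _; rewrite nth_default ?mulr0 // (leq_trans (sr j)).
  have := congr1 (fun M : 'rV_4 => M 0 (Ordinal k4)) vC; rewrite !mxE => vk.
  by rewrite -[RHS]vk; apply: eq_bigr => j _; rewrite mxE.
have rz : \sum_j v 0 j *: r j = 0.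
  apply/polyP => k; rewrite coef_sum coef0 -[RHS](vC' k).
  by apply: eq_bigr => j _; rewrite coefZ.
have := congr1 (fun p => (toL p).[a]) rz.
rewrite rmorph_sum horner_sum rmorph0 horner0 => rza; rewrite -[RHS]rza.
by apply: eq_bigr => j _; rewrite /= map_polyZ hornerZ -ur mulr_algl.
Qed.
End FiniteField.

(** * Quartics with equal invariants *)

(** The binary form attached to [GIIIa s t], over a general ring so that its arguments can be
    scalars or linear polynomials. *)
Definition quartic_form (R : pzRingType) (s t u v : R) : R :=
  u ^+ 4 - 2 * u ^+ 3 * v - s * u ^+ 2 * v ^+ 2 - 2 * t * u * v ^+ 3
  + t * v ^+ 4.

Lemma rmorph_quartic_form (R S : pzRingType) (f : {rmorphism R -> S}) s t u v :
  f (quartic_form s t u v) = quartic_form (f s) (f t) (f u) (f v).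
Proof.
by rewrite /quartic_form !(rmorph_nat, rmorphXn, rmorphB, rmorphD, rmorphM).
Qed.

Lemma size_GIIIa (K : fieldType) (s t : K) : size (GIIIa s t) = 5%N.
Proof.
rewrite /GIIIa -!addrA size_polyDl size_polyXn //.
rewrite (leq_ltn_trans (size_polyD _ _)) // gtn_max size_polyN.
rewrite (leq_ltn_trans (size_scale_leq _ _)) ?size_polyXn //=.
rewrite (leq_ltn_trans (size_polyD _ _)) // gtn_max size_polyN.
rewrite (leq_ltn_trans (size_scale_leq _ _)) ?size_polyXn //=.
rewrite (leq_ltn_trans (size_polyD _ _)) // gtn_max size_polyN.
rewrite (leq_ltn_trans (size_scale_leq _ _)) ?size_polyX //=.
by rewrite size_polyC; case: (_ != _).
Qed.

Lemma coef_GIIIa (K : fieldType) (s t : K) i :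
  (GIIIa s t)`_i = [:: t; - (2 * t); - s; - 2; 1]`_i.
Proof.
rewrite /GIIIa !(coefD, coefN, coefZ, coefC, coefX, coefXn).
case: i => [|[|[|[|[|i]]]]] /=; rewrite ?nth_nil;
by rewrite !(mulr0, mulr1, add0r, addr0, subr0, sub0r, oppr0).
Qed.

Lemma monic_GIIIa (K : fieldType) (s t : K) : GIIIa s t \is monic.
Proof. by rewrite monicE lead_coefE size_GIIIa coef_GIIIa. Qed.

Section QuarticSubstitution.
Variables (K : fieldType) (s t m1 m2 m3 m4 : K).

Definition quartic_sub4 := quartic_form s t m1 m3.
Definition quartic_sub3 := 4 * m1 ^+ 3 * m2 - 2 * (3 * m1 ^+ 2 * m2 * m3 + m1 ^+ 3 * m4)
  - s * (2 * m1 * m2 * m3 ^+ 2 + 2 * m1 ^+ 2 * m3 * m4)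
  - 2 * t * (m2 * m3 ^+ 3 + 3 * m1 * m3 ^+ 2 * m4) + 4 * t * m3 ^+ 3 * m4.
Definition quartic_sub2 := 6 * m1 ^+ 2 * m2 ^+ 2
  - 2 * (3 * m1 * m2 ^+ 2 * m3 + 3 * m1 ^+ 2 * m2 * m4)
  - s * (m2 ^+ 2 * m3 ^+ 2 + 4 * m1 * m2 * m3 * m4 + m1 ^+ 2 * m4 ^+ 2)
  - 2 * t * (3 * m2 * m3 ^+ 2 * m4 + 3 * m1 * m3 * m4 ^+ 2)
  + 6 * t * m3 ^+ 2 * m4 ^+ 2.
Definition quartic_sub1 := 4 * m1 * m2 ^+ 3 - 2 * (m2 ^+ 3 * m3 + 3 * m1 * m2 ^+ 2 * m4)
  - s * (2 * m2 ^+ 2 * m3 * m4 + 2 * m1 * m2 * m4 ^+ 2)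
  - 2 * t * (m1 * m4 ^+ 3 + 3 * m2 * m3 * m4 ^+ 2) + 4 * t * m3 * m4 ^+ 3.
Definition quartic_sub0 := quartic_form s t m2 m4.

Lemma quartic_form_sub :
  quartic_form s%:P t%:P (m1%:P * 'X + m2%:P) (m3%:P * 'X + m4%:P) =
  quartic_sub4%:P * 'X^4 + quartic_sub3%:P * 'X^3 + quartic_sub2%:P * 'X^2
  + quartic_sub1%:P * 'X + quartic_sub0%:P.
Proof.
rewrite /quartic_sub4 /quartic_sub3 /quartic_sub2 /quartic_sub1 /quartic_sub0.
by rewrite /quartic_form; ring.
Qed.

Lemma coef_quartic_form_sub i :
  (quartic_form s%:P t%:P (m1%:P * 'X + m2%:P) (m3%:P * 'X + m4%:P))`_i =
  [:: quartic_sub0; quartic_sub1; quartic_sub2; quartic_sub3; quartic_sub4]`_i.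
Proof.
rewrite quartic_form_sub !coefD !coefCM coefC coefX !coefXn.
case: i => [|[|[|[|[|i]]]]] /=; rewrite ?nth_nil;
by rewrite !(mulr0, mulr1, add0r, addr0).
Qed.

Let D := m1 * m4 - m2 * m3.
Local Notation p3 := (num_sub3 s t m1 m3).
Local Notation p2 := (num_sub2 s t m1 m2 m3 m4).
Local Notation p1 := (num_sub1 s t m1 m2 m3 m4).
Local Notation p0 := (num_sub0 s t m2 m4).
Local Notation q3 := (den_sub3 m1 m3).
Local Notation q2 := (den_sub2 m1 m2 m3 m4).
Local Notation q1 := (den_sub1 m1 m2 m3 m4).
Local Notation q0 := (den_sub0 m2 m4).

(** The left-hand sides are the coefficients of the Wronskian [P' Q - P Q'] of the substituted
    pencil; it is a covariant, equal to [G_{s,t}] before substitution. *)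
Lemma wronskian_sub :
  [/\ p3 * q2 - p2 * q3 = D * quartic_sub4,
      2 * (p3 * q1 - p1 * q3) = D * quartic_sub3,
      3 * (p3 * q0 - p0 * q3) + (p2 * q1 - p1 * q2) = D * quartic_sub2,
      2 * (p2 * q0 - p0 * q2) = D * quartic_sub1 &
      p1 * q0 - p0 * q1 = D * quartic_sub0].
Proof.
rewrite /D /num_sub3 /num_sub2 /num_sub1 /num_sub0.
rewrite /den_sub3 /den_sub2 /den_sub1 /den_sub0.
rewrite /quartic_sub4 /quartic_sub3 /quartic_sub2 /quartic_sub1 /quartic_sub0.
rewrite /quartic_form.
by split; ring.
Qed.
End QuarticSubstitution.

(** * Resolvent cubic and cross-ratio of the four roots *)

Section QuarticIdentities.
Variables (L : fieldType).
Implicit Types s t x y : L.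

Lemma GIIIa_vieta s t x0 x1 x2 x3 :
  GIIIa s t = ('X - x0%:P) * ('X - x1%:P) * ('X - x2%:P) * ('X - x3%:P) ->
  [/\ x0 + x1 + x2 + x3 = 2,
      x0 * x1 + x0 * x2 + x0 * x3 + x1 * x2 + x1 * x3 + x2 * x3 = - s,
      x0 * x1 * x2 + x0 * x1 * x3 + x0 * x2 * x3 + x1 * x2 * x3 = 2 * t
    & x0 * x1 * x2 * x3 = t].
Proof.
have -> : ('X - x0%:P) * ('X - x1%:P) * ('X - x2%:P) * ('X - x3%:P) =
  'X^4 - (x0 + x1 + x2 + x3)%:P * 'X^3
  + (x0 * x1 + x0 * x2 + x0 * x3 + x1 * x2 + x1 * x3 + x2 * x3)%:P * 'X^2
  - (x0 * x1 * x2 + x0 * x1 * x3 + x0 * x2 * x3 + x1 * x2 * x3)%:P * 'X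
  + (x0 * x1 * x2 * x3)%:P.
  by rewrite !(rmorphD, rmorphM) /=; ring.
move=> e; have C i := congr1 (fun p : {poly L} => p`_i) e.
have := (C 0%N, C 1%N, C 2%N, C 3%N); rewrite !coef_GIIIa.
rewrite !(coefD, coefN, coefCM, coefC, coefX, coefXn) /=.
rewrite !(mulr0, mulr1, subr0, add0r, addr0, oppr0, sub0r).
by move=> [[[-> /oppr_inj <-] ->] /oppr_inj <-].
Qed.

(** [E] is a root of the resolvent cubic, and [d] is the difference of the other two roots
    [x0 x1 + x2 x3] and [x0 x3 + x1 x2]. Their sum and product are expressible through [E] and the
    coefficients, which gives the square of [d]. *)
Lemma GIIIa_resolvent s t x0 x1 x2 x3
    (E := x0 * x2 + x1 * x3) (d := (x0 - x2) * (x1 - x3)) :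
  GIIIa s t = ('X - x0%:P) * ('X - x1%:P) * ('X - x2%:P) * ('X - x3%:P) ->
  E ^+ 3 + s * E ^+ 2 = 4 * (t * (1 + s + t)) /\
  d ^+ 2 = (s + E) * (s - 3 * E).
Proof.
move=> /GIIIa_vieta.
set e1 := x0 + x1 + x2 + x3.
set e2 := x0 * x1 + x0 * x2 + x0 * x3 + x1 * x2 + x1 * x3 + x2 * x3.
set e3 := x0 * x1 * x2 + x0 * x1 * x3 + x0 * x2 * x3 + x1 * x2 * x3.
set e4 := x0 * x1 * x2 * x3 => -[h1 h2 h3 h4].
have sE : s = - e2 by rewrite h2 opprK.
split.
  have -> : E ^+ 3 + s * E ^+ 2 =
    e3 ^+ 2 + e1 ^+ 2 * e4 - 4 * e2 * e4 - (e1 * e3 - 4 * e4) * E.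
    by rewrite sE /E /e1 /e2 /e3 /e4; ring.
  by rewrite h1 h3 h4 h2; ring.
have -> : d ^+ 2 = (e2 - E) ^+ 2 - 4 * (e1 * e3 - 4 * e4 - E * (e2 - E)).
  by rewrite /d /E /e1 /e2 /e3 /e4; ring.
by rewrite h1 h3 h4 h2; ring.
Qed.

(* [(1 + u)(1 - 3 u)] is the discriminant of [(U^3 + U^2 - u^3 - u^2) / (U - u)]. *)
Lemma resolvent_root_eq (sigma : {rmorphism L -> L}) (u u' d : L) :
  2 != 0 :> L -> sigma u = u -> sigma u' = u' -> sigma d = - d -> d != 0 ->
  d ^+ 2 = (1 + u) * (1 - 3 * u) -> u ^+ 3 + u ^+ 2 = u' ^+ 3 + u' ^+ 2 ->
  u = u'.
Proof.
move=> n2 su su' sd d0 d2 e; apply: contraNeq d0 => nuu.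
have e2 : u ^+ 2 + u * u' + u' ^+ 2 + u + u' = 0.
  have : (u - u') * (u ^+ 2 + u * u' + u' ^+ 2 + u + u') = 0.
    by transitivity (u ^+ 3 + u ^+ 2 - (u' ^+ 3 + u' ^+ 2)); [ring | rewrite e subrr].
  by move/eqP; rewrite mulf_eq0 subr_eq0 (negPf nuu) => /eqP.
(* By [e2], [u'] is a root of [U^2 + (1 + u) U + u (1 + u)], so completing the square gives a root
   of the discriminant that is fixed by [sigma], whereas [sigma] negates [d]. *)
have : d ^+ 2 == (2 * u' + u + 1) ^+ 2.
  rewrite d2 -subr_eq0; apply/eqP.
  by transitivity (- 4 * (u ^+ 2 + u * u' + u' ^+ 2 + u + u')); [ring | rewrite e2 mulr0].
have fix_ : sigma (2 * u' + u + 1) = 2 * u' + u + 1.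
  by rewrite !(rmorphD, rmorphM, rmorph_nat, rmorph1) su su'.
have sd0 : sigma d = d -> d == 0.
  rewrite sd => e3; have : d + d == 0 by rewrite -{1}e3 addNr.
  rewrite -mulr2n -mulr_natl.
  by rewrite mulf_eq0 (negPf n2).
rewrite eqf_sqr => /orP[] /eqP dE; apply: sd0; rewrite dE ?rmorphN ?fix_ //.
Qed.

Lemma det_1xyxy (x y : nat -> L) :
  \det (\matrix_(j < 4, i < 4) [:: 1; x i; y i; x i * y i]`_j) =
  (x 0 - x 1) * (x 2 - x 3) * ((y 0 - y 3) * (y 1 - y 2)) -
  (x 0 - x 3) * (x 1 - x 2) * ((y 0 - y 1) * (y 2 - y 3)).
Proof.
rewrite (expand_det_row _ 0) !big_ord_recl big_ord0 /cofactor.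
rewrite !(expand_det_row _ 0) !big_ord_recl !big_ord0 /cofactor.
rewrite !(expand_det_row _ 0) !big_ord_recl !big_ord0 /cofactor.
rewrite !det_mx11 !mxE /= /bump /= !(add1n, add0n, addn0).
ring.
Qed.

(** Twice [(x0 - x3)(x1 - x2)] is [d - z] and twice [(x0 - x1)(x2 - x3)] is [d + z], and likewise
    for the [y]. Proportional pairs [(z, d)] and [(z', d')] thus give equal cross-ratios. *)
Lemma cross_products_eq (x0 x1 x2 x3 y0 y1 y2 y3 S S' : L) :
  2 != 0 :> L -> S' != 0 ->
  x0 * x1 + x0 * x2 + x0 * x3 + x1 * x2 + x1 * x3 + x2 * x3 = - S ->
  y0 * y1 + y0 * y2 + y0 * y3 + y1 * y2 + y1 * y3 + y2 * y3 = - S' ->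
  (x0 * x2 + x1 * x3) * S' = (y0 * y2 + y1 * y3) * S ->
  (x0 - x2) * (x1 - x3) * S' = (y0 - y2) * (y1 - y3) * S ->
  (x0 - x3) * (x1 - x2) * ((y0 - y1) * (y2 - y3)) =
  (x0 - x1) * (x2 - x3) * ((y0 - y3) * (y1 - y2)).
Proof.
move=> n2 S'0 ex ey eE eD.
pose z := 3 * (x0 * x2 + x1 * x3) + S; pose d := (x0 - x2) * (x1 - x3).
pose z' := 3 * (y0 * y2 + y1 * y3) + S'; pose d' := (y0 - y2) * (y1 - y3).
have zE : z = 3 * (x0 * x2 + x1 * x3) - - S by rewrite opprK.
have zE' : z' = 3 * (y0 * y2 + y1 * y3) - - S' by rewrite opprK.
have eZ : z * S' = z' * S.
  by rewrite /z /z' !mulrDl -!mulrA eE (mulrC S').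
have n4 : 4 != 0 :> L by rewrite (_ : 4 = 2 * 2) ?mulf_neq0 //; ring.
apply: (mulfI n4); apply: (mulfI S'0).
transitivity (S' * ((d - z) * (z' + d'))).
  by rewrite zE zE' -ex -ey /d /d'; ring.
transitivity (S' * ((z + d) * (d' - z'))); last first.
  by rewrite zE zE' -ex -ey /d /d'; ring.
transitivity (d * S' * (z' + d') - z * S' * (z' + d')); first by ring.
transitivity (z * S' * (d' - z') + d * S' * (d' - z')); last by ring.
have eD' : d * S' = d' * S := eD.
by rewrite eZ eD'; ring.
Qed.

Lemma quartic_form_root (s t a u v : L) : a * v = u -> root (GIIIa s t) a ->
  quartic_form s t u v = 0.
Proof.
move=> <- /rootP e; transitivity ((GIIIa s t).[a] * v ^+ 4).
  rewrite /GIIIa !(hornerD, hornerN, hornerZ, hornerXn, hornerX, hornerC).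
  by rewrite /quartic_form; ring.
by rewrite e mul0r.
Qed.

Lemma quartic_form_factor (s t x0 x1 x2 x3 u v : L) :
  GIIIa s t = ('X - x0%:P) * ('X - x1%:P) * ('X - x2%:P) * ('X - x3%:P) ->
  quartic_form s t u v =
    (u - x0 * v) * (u - x1 * v) * (u - x2 * v) * (u - x3 * v).
Proof.
move=> /GIIIa_vieta [e1 e2 e3 e4].
transitivity (u ^+ 4 - 2 * u ^+ 3 * v + - s * u ^+ 2 * v ^+ 2
              - (2 * t) * u * v ^+ 3 + t * v ^+ 4).
  by rewrite /quartic_form; ring.
by rewrite -e3 -e1 -e2 -e4; ring.
Qed.
End QuarticIdentities.

(** * Descent of the projective map to the finite field *)

Section Descent.
Variables (F : finFieldType) (L : splittingFieldType F).
Variables (sigma : {rmorphism L -> L}) (sigmaE : forall x, sigma x = x ^+ #|F|).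
Local Notation toL := (map_poly (in_alg L)).
Local Notation fd := (frobenius_alg sigmaE).

Lemma frobenius2_lin (a : L) (p q : F) : sigma (sigma a) != a ->
  p%:A * a + q%:A = 0 -> p = 0 /\ q = 0.
Proof.
move=> n2 e; have [p0|p0] := eqVneq p 0.
  move: e; rewrite p0 scale0r mul0r add0r => /eqP.
  by rewrite scaler_eq0 oner_eq0 orbF => /eqP.
case/eqP: n2; suff s1 : sigma a = a by rewrite !s1.
have pA : p%:A != 0 :> L by rewrite scaler_eq0 oner_eq0 orbF.
apply: (mulfI pA); apply: (addIr q%:A); rewrite e.
by rewrite -[p%:A]fd -[q%:A]fd -rmorphM -rmorphD e rmorph0.
Qed.

Lemma moebius_descent (G H : {poly F}) (a b : L)
    (x := fun i => iter i sigma a) (y := fun i => iter i sigma b) :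
  irreducible_poly G -> root (toL G) a -> size G = 5%N ->
  irreducible_poly H -> root (toL H) b -> size H = 5%N ->
  (x 0 - x 3) * (x 1 - x 2) * ((y 0 - y 1) * (y 2 - y 3)) =
  (x 0 - x 1) * (x 2 - x 3) * ((y 0 - y 3) * (y 1 - y 2)) ->
  exists m1 m2 m3 m4 : F, m1 * m4 - m2 * m3 != 0 /\
    a * (m3%:A * b + m4%:A) = m1%:A * b + m2%:A.
Proof.
move=> iG rG sG iH rH sH cross.
have na := frobenius2_neq sigmaE iG rG sG.
have nb := frobenius2_neq sigmaE iH rH sH.
have bP : b \in <<1; a>>%VS.
  by rewrite (adjoin_root_eq iG rG iH rH) ?sG ?sH // memv_adjoin.
have aP : a \in <<1; a>>%VS by rewrite memv_adjoin.
pose u (j : 'I_4) := [:: 1; a; b; a * b]`_j.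
have [||v v0] := adjoin_dep sigmaE (u := u) iG rG sG.
- by case=> [[|[|[|[|j]]]] lj] //; rewrite /u /= ?mem1v ?rpredM.
- transitivity (\det (\matrix_(j < 4, i < 4) [:: 1; x i; y i; x i * y i]`_j)).
    congr (\det _); apply/matrixP => j i; rewrite !mxE /u /x /y.
    move: (nat_of_ord i) => {}i; case: j => [[|[|[|[|j]]]] lj] //=;
      elim: i => [|i IH] //=.
      by rewrite IH rmorph1.
    by rewrite IH rmorphM.
  by rewrite det_1xyxy cross subrr.
rewrite !big_ord_recl big_ord0 /u /= /bump /= !(add1n, add0n, addn0, addr0) /=.
set v1 := v 0 _; set v2 := v 0 _; set v3 := v 0 _; set v4 := v 0 _ => rel.
have vz : v1 = 0 -> v2 = 0 -> v3 = 0 -> v4 = 0 -> False.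
  move=> e1 e2 e3 e4; case/eqP: v0; apply/rowP => -[[|[|[|[|j]]]] lj] //.
  - by rewrite mxE -[RHS]e1; congr (v _ _); apply: val_inj.
  - by rewrite mxE -[RHS]e2; congr (v _ _); apply: val_inj.
  - by rewrite mxE -[RHS]e3; congr (v _ _); apply: val_inj.
  - by rewrite mxE -[RHS]e4; congr (v _ _); apply: val_inj.
clearbody v1 v2 v3 v4; exists (- v3), (- v1), v4, v2.
have e : a * (v4%:A * b + v2%:A) = (- v3)%:A * b + (- v1)%:A.
  apply/eqP; rewrite -subr_eq0 -[X in _ == X]rel; apply/eqP.
  by rewrite -(mulr_algl v2 a) -(mulr_algl v3 b) -(mulr_algl v4 (a * b)) !scaleNr; ring.
split=> //.
(* If the denominator vanished, so would the numerator, and the independence of [1] and [b] over [F]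
   would annihilate all four coefficients. *)
have den0 : v4%:A * b + v2%:A != 0 :> L.
  apply/eqP => z; have [z4 z2] := frobenius2_lin nb z.
  move: e; rewrite z mulr0 => /esym e; have [/eqP + /eqP] := frobenius2_lin nb e.
  by rewrite !oppr_eq0 => /eqP z3 /eqP z1; apply: vz.
(* With proportional rows the relation reduces to [v4 a = m1] and [v2 a = m2]; the independence of
   [1] and [a] then gives [v4 = v2 = 0], against [den0]. *)
apply/negP => /eqP det0.
move: e; set m1 := - v3 in det0 *; set m2 := - v1 in det0 * => e.
have det0A : m1%:A * v2%:A = m2%:A * v4%:A :> L.
  have := congr1 (in_alg L) (subr0_eq det0).
  by rewrite [LHS](rmorphM (in_alg L)) [RHS](rmorphM (in_alg L)).
have e4 : v4%:A * a + (- m1)%:A = 0.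
  apply: (mulIf den0); rewrite mul0r scaleNr.
  transitivity (v4%:A * (a * (v4%:A * b + v2%:A)) -
    m1%:A * (v4%:A * b + v2%:A)); first by ring.
  rewrite e; transitivity (m2%:A * v4%:A - m1%:A * v2%:A : L); first by ring.
  by rewrite det0A subrr.
have e2 : v2%:A * a + (- m2)%:A = 0.
  apply: (mulIf den0); rewrite mul0r scaleNr.
  transitivity (v2%:A * (a * (v4%:A * b + v2%:A)) -
    m2%:A * (v4%:A * b + v2%:A)); first by ring.
  rewrite e; transitivity ((m1%:A * v2%:A - m2%:A * v4%:A) * b); first by ring.
  by rewrite det0A subrr mul0r.
have [z4 _] := frobenius2_lin na e4; have [z2 _] := frobenius2_lin na e2.
by case/eqP: den0; rewrite z4 z2 !scale0r mul0r addr0.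
Qed.

(** [pairsum] and [crossdiff] are [s u] and [s d] in the notation of the overview. *)
Definition pairsum (a : L) :=
  a * sigma (sigma a) + sigma a * sigma (sigma (sigma a)).
Definition crossdiff (a : L) :=
  (a - sigma (sigma a)) * (sigma a - sigma (sigma (sigma a))).

Lemma map_GIIIa (s t : F) : toL (GIIIa s t) = GIIIa s%:A t%:A.
Proof.
apply/polyP => i; rewrite coef_map !coef_GIIIa.
case: i => [|[|[|[|[|i]]]]]; rewrite ?nth_nil [LHS]/=;
  rewrite ?scale0r ?scale1r //.
- by rewrite -[LHS]/(in_alg L _) rmorphN rmorphM rmorph_nat.
- by rewrite -[LHS]/(in_alg L _) rmorphN.
- by rewrite -[LHS]/(in_alg L _) rmorphN rmorph_nat.
- by rewrite /= !nth_nil scale0r.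
Qed.

Section GIIIaRoot.
Variables (s t : F) (a : L).
Hypotheses (irrG : irreducible_poly (GIIIa s t)).
Hypotheses (rootG : root (toL (GIIIa s t)) a).

Lemma GIIIa_factor : GIIIa s%:A t%:A =
  ('X - a%:P) * ('X - (sigma a)%:P) * ('X - (sigma (sigma a))%:P) *
  ('X - (sigma (sigma (sigma a)))%:P).
Proof.
rewrite -map_GIIIa.
exact: (quartic_factor sigmaE irrG rootG (size_GIIIa s t) (monic_GIIIa s t)).
Qed.

Let s4 := frobenius4 sigmaE irrG rootG (size_GIIIa s t).

Lemma frobenius_pairsum : sigma (pairsum a) = pairsum a.
Proof. by rewrite /pairsum rmorphD !rmorphM s4; ring. Qed.

Lemma frobenius_crossdiff : sigma (crossdiff a) = - crossdiff a.
Proof. by rewrite /crossdiff rmorphM !rmorphB s4; ring. Qed.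

Lemma crossdiff_frobenius : crossdiff (sigma a) = - crossdiff a.
Proof. by rewrite /crossdiff s4; ring. Qed.

Lemma pairsum_frobenius : pairsum (sigma a) = pairsum a.
Proof. by rewrite /pairsum s4; ring. Qed.

Lemma crossdiff_neq0 : crossdiff a != 0.
Proof.
have n2 := frobenius2_neq sigmaE irrG rootG (size_GIIIa s t).
rewrite mulf_neq0 ?subr_eq0 // eq_sym ?n2 //.
by rewrite (inj_eq (fmorph_inj sigma)).
Qed.

Lemma root_GIIIa_frobenius : root (toL (GIIIa s t)) (sigma a).
Proof.
apply/rootP; rewrite -(frobenius_horner sigmaE) (rootP rootG).
exact: rmorph0.
Qed.
End GIIIaRoot.

Lemma GIIIa_descent_aux (s t s' t' : F) (a b : L) :
  2 != 0 :> L -> s != 0 -> s' != 0 ->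
  irreducible_poly (GIIIa s t) -> root (toL (GIIIa s t)) a ->
  irreducible_poly (GIIIa s' t') -> root (toL (GIIIa s' t')) b ->
  pairsum a * s'%:A = pairsum b * s%:A ->
  crossdiff a * s'%:A = crossdiff b * s%:A ->
  exists m1 m2 m3 m4 c : F,
    [/\ m1 * m4 - m2 * m3 != 0, c != 0, c * s' = (m1 * m4 - m2 * m3) ^+ 2 * s &
      quartic_form s%:P t%:P (m1%:P * 'X + m2%:P) (m3%:P * 'X + m4%:P) =
        c *: GIIIa s' t'].
Proof.
move=> n2 s0 s'0 iG rG iH rH eE eD.
have s0A : s%:A != 0 :> L by rewrite scaler_eq0 oner_eq0 orbF.
have s'0A : s'%:A != 0 :> L by rewrite scaler_eq0 oner_eq0 orbF.
have [e1 e2 e3 e4] := GIIIa_vieta (GIIIa_factor iG rG).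
have [e1' e2' e3' e4'] := GIIIa_vieta (GIIIa_factor iH rH).
have := @moebius_descent _ _ a b iG rG (size_GIIIa s t) iH rH (size_GIIIa s' t').
rewrite /= => -[|m1 [m2 [m3 [m4 [det0 mobE]]]]].
  exact: (cross_products_eq n2 s'0A e2 e2' eE eD).
have mobE1 := congr1 sigma mobE; rewrite !(rmorphM, rmorphD) /= !fd in mobE1.
have mobE2 := congr1 sigma mobE1; rewrite !(rmorphM, rmorphD) /= !fd in mobE2.
have mobE3 := congr1 sigma mobE2; rewrite !(rmorphM, rmorphD) /= !fd in mobE3.
pose D := m1 * m4 - m2 * m3.
pose R := quartic_form s%:P t%:P (m1%:P * 'X + m2%:P) (m3%:P * 'X + m4%:P).
have lin (p q : F) y : (toL (p%:P * 'X + q%:P)).[y] = p%:A * y + q%:A.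
  rewrite rmorphD rmorphM /= !map_polyC map_polyX.
  by rewrite !(hornerD, hornerM, hornerC, hornerX).
have RE y : (toL R).[y] =
    quartic_form s%:A t%:A (m1%:A * y + m2%:A) (m3%:A * y + m4%:A).
  rewrite /R rmorph_quartic_form -/(horner_eval y _) rmorph_quartic_form /=.
  by rewrite /horner_eval !lin /= !map_polyC !hornerC.
have rR : root (toL R) b.
  by apply/rootP; rewrite RE; apply: quartic_form_root mobE _; rewrite -map_GIIIa.
(* The leading coefficient of [R]: then [R - c *: GIIIa s' t'] has degree at most 3 and is divisible
   by the irreducible quartic, hence is zero. *)
pose c := quartic_form s t m1 m3.
have RH : R = c *: GIIIa s' t'.
  apply/eqP; rewrite -subr_eq0; apply/negPn/negP => nz.
  have dv : GIIIa s' t' %| R - c *: GIIIa s' t'.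
    by rewrite dvdp_sub ?dvdp_mulIr -?mul_polyC ?dvdp_mull //
      (irreducible_dvdp_root iH rH rR).
  have := dvdp_leq nz dv; rewrite size_GIIIa leqNgt ltnS => /negP; apply.
  apply/leq_sizeP => -[|[|[|[|[|j]]]]] // _;
    rewrite coefB coefZ coef_quartic_form_sub coef_GIIIa /=.
    by rewrite mulr1 subrr.
  by rewrite !nth_nil mulr0 subrr.
pose v i := m3%:A * iter i sigma b + m4%:A.
have lineq (x y : L) : x * (m3%:A * y + m4%:A) = m1%:A * y + m2%:A ->
    (m1%:A - x * m3%:A) * (m3%:A * y + m4%:A) = D%:A.
  move=> e; rewrite mulrBl mulrAC e -[RHS]/(in_alg L D).
  by rewrite rmorphB !rmorphM /=; ring.
have diff (x y x' y' : L) : x * (m3%:A * y + m4%:A) = m1%:A * y + m2%:A ->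
    x' * (m3%:A * y' + m4%:A) = m1%:A * y' + m2%:A ->
    (x - x') * ((m3%:A * y + m4%:A) * (m3%:A * y' + m4%:A)) = D%:A * (y - y').
  move=> e e'; rewrite mulrBl mulrA e mulrCA e' -[D%:A]/(in_alg L D).
  by rewrite rmorphB !rmorphM /=; ring.
have D0A : D%:A != 0 :> L by rewrite scaler_eq0 oner_eq0 orbF.
(* The norm of [m3 b + m4]. As [c] is the product of the [m1 - x_i m3], each equal to [D / v i], it
   satisfies [c N = D^4]; each difference of roots scales by [D / (v i * v j)]. Comparing the two
   [crossdiff] then yields [c s' = D^2 s]. *)
pose N := v 0%N * v 1%N * v 2%N * v 3%N.
have cN : c%:A * N = D%:A ^+ 4.
  rewrite -[c%:A]/(in_alg L c) rmorph_quartic_form /=.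
  rewrite (quartic_form_factor _ _ (GIIIa_factor iG rG)).
  transitivity (
   ((m1%:A - a * m3%:A) * v 0%N) * ((m1%:A - sigma a * m3%:A) * v 1%N) *
   ((m1%:A - sigma (sigma a) * m3%:A) * v 2%N) *
   ((m1%:A - sigma (sigma (sigma a)) * m3%:A) * v 3%N)).
    by rewrite /N; ring.
  rewrite /v /= (lineq _ _ mobE) (lineq _ _ mobE1) (lineq _ _ mobE2).
  by rewrite (lineq _ _ mobE3); ring.
have dN : crossdiff a * N = D%:A ^+ 2 * crossdiff b.
  rewrite /crossdiff /N.
  transitivity (((a - sigma (sigma a)) * (v 0%N * v 2%N)) *
   ((sigma a - sigma (sigma (sigma a))) * (v 1%N * v 3%N))); first by ring.
  by rewrite /v /= (diff _ _ _ _ mobE mobE2) (diff _ _ _ _ mobE1 mobE3); ring.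
have cN0 : c%:A * N != 0 by rewrite cN expf_neq0.
exists m1, m2, m3, m4, c; split=> //.
  by apply: contraNneq cN0 => ->; rewrite scale0r mul0r.
apply: (fmorph_inj (in_alg L)).
apply: (mulIf (crossdiff_neq0 iH rH)).
have N0 : N != 0 by apply: contraNneq cN0 => ->; rewrite mulr0.
apply: (mulIf N0).
rewrite -/D !(rmorphXn, rmorphM) /=.
transitivity (c%:A * N * s'%:A * crossdiff b); first by ring.
rewrite cN; transitivity (D%:A ^+ 2 * s'%:A * (D%:A ^+ 2 * crossdiff b)); first by ring.
rewrite -dN; transitivity (D%:A ^+ 2 * N * (crossdiff a * s'%:A)); first by ring.
by rewrite eD; ring.
Qed.
End Descent.

(** Splitting the product [G * H] places roots of both in one field, so that a single Frobenius acts
    on them. Each factor has positive degree, so it receives at least one of the linear factors. *)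
Lemma common_splitting_root (F : finFieldType) (G H : {poly F}) :
  irreducible_poly G -> irreducible_poly H ->
  exists (L : splittingFieldType F) (a b : L),
    root (map_poly (in_alg L) G) a /\ root (map_poly (in_alg L) H) b.
Proof.
move=> iG iH; have GH0 : G * H != 0.
  by rewrite mulf_neq0 ?irredp_neq0.
have [L [rs rsE _]] := FinSplittingFieldFor GH0.
have rootD (P : {poly F}) : irreducible_poly P -> P %| G * H ->
    exists a : L, root (map_poly (in_alg L) P) a.
  move=> [szP _] dP.
  have : map_poly (in_alg L) P %| \prod_(z <- rs) ('X - z%:P).
    by rewrite -(eqp_dvdr _ rsE) /= dvdp_map.
  move=> /dvdp_prod_XsubC [m]; case: (mask m rs) => [|z zs] e.
    move: (eqp_size e); rewrite big_nil size_poly1 size_map_poly => e1.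
    by rewrite e1 in szP.
  by exists z; rewrite (eqp_root e) big_cons rootM root_XsubC eqxx.
have [a ra] := rootD G iG (dvdp_mulr _ (dvdpp G)).
have [b rb] := rootD H iH (dvdp_mull _ (dvdpp H)).
by exists L, a, b.
Qed.

(** * Equivalence over the finite field of two [f_{s,t}] with equal invariant *)

Section EquivalenceIIIa.
Variable F : finFieldType.
Implicit Types s t : F.

Lemma GIIIa_descent s t s' t' : 2 != 0 :> F -> s != 0 -> s' != 0 ->
  irreducible_poly (GIIIa s t) -> irreducible_poly (GIIIa s' t') ->
  t * (1 + s + t) * s' ^+ 3 = t' * (1 + s' + t') * s ^+ 3 ->
  exists m1 m2 m3 m4 c : F,
    [/\ m1 * m4 - m2 * m3 != 0, c != 0, c * s' = (m1 * m4 - m2 * m3) ^+ 2 * s &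
      quartic_form s%:P t%:P (m1%:P * 'X + m2%:P) (m3%:P * 'X + m4%:P) =
        c *: GIIIa s' t'].
Proof.
move=> n2 s0 s'0 iG iH eT.
have [L [a [b [rG rH]]]] := common_splitting_root iG iH.
have [sigma sigmaE] := frobenius_rmorphism L.
have n2A : 2 != 0 :> L by rewrite -(rmorph_nat (in_alg L)) fmorph_eq0.
have s0A : s%:A != 0 :> L by rewrite scaler_eq0 oner_eq0 orbF.
have s'0A : s'%:A != 0 :> L by rewrite scaler_eq0 oner_eq0 orbF.
have [eE eD] := GIIIa_resolvent (GIIIa_factor sigmaE iG rG).
have [eE' eD'] := GIIIa_resolvent (GIIIa_factor sigmaE iH rH).
rewrite -/(pairsum sigma a) -/(pairsum sigma b) in eE eE' eD eD'.
rewrite -/(crossdiff sigma a) -/(crossdiff sigma b) in eD eD'.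
have eTA : t%:A * (1 + s%:A + t%:A) * s'%:A ^+ 3 =
    t'%:A * (1 + s'%:A + t'%:A) * s%:A ^+ 3 :> L.
  have := congr1 (in_alg L) eT.
  by rewrite !(rmorphXn, rmorphD, rmorphM, rmorph1).
pose u := pairsum sigma a / s%:A; pose u' := pairsum sigma b / s'%:A.
pose d := crossdiff sigma a / s%:A; pose d' := crossdiff sigma b / s'%:A.
have fd := frobenius_alg sigmaE.
have uE : pairsum sigma a = u * s%:A by rewrite divfK.
have uE' : pairsum sigma b = u' * s'%:A by rewrite divfK.
have dE : crossdiff sigma a = d * s%:A by rewrite divfK.
have dE' : crossdiff sigma b = d' * s'%:A by rewrite divfK.
have su : sigma u = u.
  by rewrite fmorph_div (frobenius_pairsum sigmaE iG rG) fd.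
have su' : sigma u' = u'.
  by rewrite fmorph_div (frobenius_pairsum sigmaE iH rH) fd.
have sd : sigma d = - d.
  by rewrite fmorph_div (frobenius_crossdiff sigmaE iG rG) fd mulNr.
have d0 : d != 0 by rewrite mulf_neq0 ?invr_eq0 ?(crossdiff_neq0 sigmaE iG rG).
have d2 : d ^+ 2 = (1 + u) * (1 - 3 * u).
  apply: (mulIf (expf_neq0 2 s0A)); rewrite -exprMn -dE eD uE; ring.
have d2' : d' ^+ 2 = (1 + u') * (1 - 3 * u').
  apply: (mulIf (expf_neq0 2 s'0A)); rewrite -exprMn -dE' eD' uE'; ring.
have uu : u = u'.
  apply: (resolvent_root_eq n2A su su' sd d0 d2).
  (* Clearing denominators turns the two cubics in [u] and [u'] into the two resolvent equations,
     whose constant sides agree by [eTA]. *)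
  apply: (mulIf (expf_neq0 3 s0A)); apply: (mulIf (expf_neq0 3 s'0A)).
  transitivity ((pairsum sigma a ^+ 3 + s%:A * pairsum sigma a ^+ 2) * s'%:A ^+ 3).
    by rewrite uE; ring.
  transitivity ((pairsum sigma b ^+ 3 + s'%:A * pairsum sigma b ^+ 2) * s%:A ^+ 3).
    by rewrite eE eE' -[LHS]mulrA eTA [LHS]mulrA.
  by rewrite uE'; ring.
have /eqP : d ^+ 2 = d' ^+ 2 by rewrite d2 d2' uu.
have eP : pairsum sigma a * s'%:A = pairsum sigma b * s%:A.
  by rewrite uE uE' uu; ring.
rewrite eqf_sqr => /orP[] /eqP dd.
  apply: (GIIIa_descent_aux sigmaE n2A s0 s'0 iG rG iH rH eP).
  by rewrite dE dE' dd; ring.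
(* Opposite signs: passing from [b] to [sigma b] negates [crossdiff] and preserves [pairsum]. *)
have rH' := root_GIIIa_frobenius sigmaE rH.
apply: (GIIIa_descent_aux sigmaE n2A s0 s'0 iG rG iH rH').
  by rewrite (pairsum_frobenius sigmaE iH rH).
by rewrite (crossdiff_frobenius sigmaE iH rH) dE dE' dd; ring.
Qed.

(** A pencil is determined by its six 2 by 2 minors. The Wronskian yields four of them, dividing by
    2 in two cases; its middle coefficient and the apolar invariant are two independent combinations
    of the remaining two, separated by dividing by 6. *)
Lemma fIIIa_requiv s t s' t' : 2 != 0 :> F -> 3 != 0 :> F -> s != 0 -> s' != 0 ->
  irreducible_poly (GIIIa s t) -> irreducible_poly (GIIIa s' t') ->
  t * (1 + s + t) * s' ^+ 3 = t' * (1 + s' + t') * s ^+ 3 ->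
  requiv (fIIIa s t) (fIIIa s' t').
Proof.
move=> n2 n3 s0 s'0 iG iH eT.
have [m1 [m2 [m3 [m4 [c [det0 c0 cE RE]]]]]] := GIIIa_descent n2 s0 s'0 iG iH eT.
have C i := congr1 (fun p : {poly F} => p`_i) RE.
have := (C 0%N, C 1%N, C 2%N, C 3%N, C 4%N).
rewrite !coef_quartic_form_sub !coefZ !coef_GIIIa /= mulr1.
move=> [[[[r0 r1] r2] r3] r4].
have [w4 w3 w2 w1 w0] := wronskian_sub s t m1 m2 m3 m4.
have ap := apolar_sub s t m1 m2 m3 m4.
rewrite r0 in w0; rewrite r1 in w1; rewrite r2 in w2; rewrite r3 in w3; rewrite r4 in w4.
have fE := ratcomp_fIIIa_moebius s t det0.
move: fE ap w4 w3 w2 w1 w0; rewrite /apolar.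
move: (num_sub3 _ _ _ _) (num_sub2 _ _ _ _ _ _) (num_sub1 _ _ _ _ _ _) (num_sub0 _ _ _ _).
move: (den_sub3 _ _) (den_sub2 _ _ _ _) (den_sub1 _ _ _ _) (den_sub0 _ _).
set D := m1 * m4 - _ in det0 cE *.
move=> q3 q2 q1 q0 p3 p2 p1 p0 fE ap w4 w3 w2 w1 w0.
pose k := D * c; have k0 : k != 0 by rewrite mulf_neq0.
have v31 : p3 * q1 - p1 * q3 = - k.
  by apply: (mulfI n2); rewrite w3 /k; ring.
have v20 : p2 * q0 - p0 * q2 = - (k * t').
  by apply: (mulfI n2); rewrite w1 /k; ring.
have n6 : 2 * 3 != 0 :> F by rewrite mulf_neq0.
have v30 : p3 * q0 - p0 * q3 = 0.
  apply: (mulfI n6); rewrite mulr0.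
  transitivity (3 * (p3 * q0 - p0 * q3) + (p2 * q1 - p1 * q2)
    + (p1 * q2 - p2 * q1 - 3 * (p0 * q3 - p3 * q0))); first by ring.
  rewrite w2 ap; transitivity (D * (D ^+ 2 * s) - D * (c * s')); first by ring.
  by rewrite cE subrr.
have v21 : p2 * q1 - p1 * q2 = - (k * s').
  by move: w2; rewrite v30 mulr0 add0r => ->; rewrite /k; ring.
have detk : q2 * p3 - - p2 * - q3 = k by rewrite /k -w4; ring.
have q0n : tofrac (cubic q3 q2 q1 q0) != 0.
  apply: cubic_neq0; apply: contraNT k0.
  rewrite !negb_or !negbK => /and4P[/eqP z3 /eqP z2 _ _].
  by rewrite -detk z3 z2; apply/eqP; ring.
(* Up to scale, the inverse of the matrix of [X^3] and [X^2] coefficients: it removes [X^2] from the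
   numerator and [X^3] from the denominator, and leaves minors of the pencil as the other
   coefficients. *)
exists (moebius q2 (- p2) (- q3) p3), (moebius m1 m2 m3 m4).
split; first by exists q2, (- p2), (- q3), p3; split; rewrite // detk.
  by exists m1, m2, m3, m4.
rewrite fE ratcomp_moebius_frac ?detk //.
have -> : q2 * p3 + - p2 * q3 = k * 1 by rewrite /k -w4; ring.
have -> : q2 * p2 + - p2 * q2 = k * 0 by ring.
have -> : q2 * p1 + - p2 * q1 = k * s' by rewrite -[RHS]opprK -v21; ring.
have -> : q2 * p0 + - p2 * q0 = k * t' by rewrite -[RHS]opprK -v20; ring.
have -> : - q3 * p3 + p3 * q3 = k * 0 by ring.
have -> : - q3 * p2 + p3 * q2 = k * 1 by rewrite /k -w4; ring.
have -> : - q3 * p1 + p3 * q1 = k * -1 by rewrite mulrN1 -v31; ring.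
have -> : - q3 * p0 + p3 * q0 = k * 0 by rewrite mulr0 -v30; ring.
have kC (x3 x2 x1 x0 : F) : tofrac (cubic (k * x3) (k * x2) (k * x1) (k * x0)) =
    ratC k * tofrac (cubic x3 x2 x1 x0).
  by rewrite !tofrac_cubic !rmorphM !mulrDr !mulrA.
rewrite !kC -mulf_div divff ?fmorph_eq0 // mul1r.
exact: fIIIa_frac.
Qed.
End EquivalenceIIIa.

(** * From equal theta to equivalence *)

(** The default of [xget] and the first alternative of [theta_spec] both give 0, so a nonzero value
    comes from the second alternative. *)
Lemma theta_neq0_spec (K : fieldType) (f : ratfun K) : theta f <> 0 ->
  exists2 T : K, T != 0 & theta f = T^-1 /\ requiv f (normal_form T).
Proof.
rewrite /theta; case: xgetP => // v -> [_ _ [[-> _] // | [T [T0 vE fE]]]] _.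
by exists T.
Qed.

Theorem theorem8p1 (p n q : nat) (p_prime : prime p) (p_ge5 : (5 <= p)%N)
    (n_gt0 : (0 < n)%N) (q_eq : q = (p ^ n)%N)
    (Fq : finFieldType) (card_Fq : #|Fq| = q)
    (Fqbar : closedFieldType) (iota : {rmorphism Fq -> Fqbar})
    (iota_closure : is_alg_closure iota)
    (f g : ratfun Fq) (fIII : classIIIa f) (gIII : classIIIa g)
    (theta_eq : theta (ratmap iota f) = theta (ratmap iota g))
    (theta_neq0 : theta (ratmap iota g) <> 0) :
  requiv f g.
Proof.
have charF : p \in [pchar Fq] by apply: card_finPcharP p_prime; rewrite card_Fq q_eq.
have natF k : (0 < k < 5)%N -> k%:R != 0 :> Fq.
  move=> /andP[k0 k5]; rewrite -(dvdn_pcharf charF) gtnNdvd //.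
  exact: leq_trans k5 p_ge5.
have [T T0 [eg rg]] := theta_neq0_spec theta_neq0.
have [T' T'0 [ef rf]] : exists2 T : Fqbar, T != 0 &
    theta (ratmap iota f) = T^-1 /\ requiv (ratmap iota f) (normal_form T).
  by apply: theta_neq0_spec; rewrite theta_eq.
have TT : T' = T by apply: invr_inj; rewrite -ef -eg.
rewrite {T' T'0 ef}TT in rf.
have [s [t [_ irrG fE]]] := fIII; have [s' [t' [_ irrH gE]]] := gIII.
(* After base change, symmetry and transitivity make [fIIIa (iota a) (iota b)] itself equivalent to
   the normal form, where its invariants can be read off. *)
have key (h : ratfun Fq) a b : requiv h (fIIIa a b) ->
    requiv (ratmap iota h) (normal_form T) ->
    a != 0 /\ iota (b * (1 + a + b)) = T * iota (a ^+ 3).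
  move=> hE hT.
  have := requiv_ratmap iota hE; rewrite ratmap_fIIIa => E1.
  have E2 := requiv_sym (@fIIIa_nonconst _ _ _) E1.
  have E3 := requiv_trans (@normal_form_nonconst _ T) E2 hT.
  have [a0 e] := requiv_fIIIa_normal_form T0 E3.
  split; first by rewrite -(fmorph_eq0 iota).
  by rewrite rmorphM !rmorphD rmorph1 rmorphXn.
have [s0 e] := key _ _ _ fE rf; have [s'0 e'] := key _ _ _ gE rg.
have R : requiv (fIIIa s t) (fIIIa s' t').
  apply: fIIIa_requiv => //; [exact: (natF 2%N) | exact: (natF 3%N) |].
  (* Under [iota] both sides become [T] times the cubes of the images of [s] and [s']. *)
  apply: (fmorph_inj iota); rewrite [LHS]rmorphM [RHS]rmorphM e e' /=; ring.
have ng : nonconst g := requiv_nonconst gE (@fIIIa_nonconst _ _ _).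
apply: requiv_trans ng (requiv_trans (@fIIIa_nonconst _ _ _) fE R) _.
exact: requiv_sym (@fIIIa_nonconst _ _ _) gE.
Qed.
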